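(* Let $G$ be a compact topological group, let $H$ be a closed subgroup of $G$, and let $X$ be a $p$-paracompact $G$-space. If $X$ is $G$-movable, then $X$, regarded as an $H$-space by restricting the action to $H$, is $H$-movable.
   Context: Conventions: all topological groups $G$ are compact (Hausdorff) and all topological spaces are $p$-paracompact, i.e. paracompact $p$-spaces in the sense of Arhangel'skii (equivalently, Hausdorff spaces admitting a perfect map onto a metrizable space). A $G$-space is a space with a continuous action $G\times X\to X$; a $G$-map is a continuous equivariant map; a $G$-homotopy is an equivariant homotopy $X\times I\to Y$ ($G$ acting trivially on $I=[0,1]$), and $G$-homotopy classes of $G$-maps are composed via representatives. $P_G$ is the class of $p$-paracompact $G$-spaces. A $G$-space $Y$ is a $G$-$ANR(P_G)$ if $Y\in P_G$ and whenever $Y$ is a closed invariant subset of a $G$-space $Z\in P_G$, there exist an invariant neighborhood $U$ of $Y$ in $Z$ and a $G$-map $r:U\to Y$ with $r|_Y=1_Y$. Below, ''$G$-$ANR$'' means $G$-$ANR(P_G)$. An inverse $G$-system $\underline{X}=\{X_\alpha,p_{\alpha\alpha'},A\}$ consists of $G$-spaces $X_\alpha$ indexed by a directed set $A$ and $G$-homotopy classes $p_{\alpha\alpha'}:X_{\alpha'}\to X_\alpha$ for $\alpha\le\alpha'$, with $p_{\alpha\alpha}=\mathrm{id}$ and $p_{\alpha\alpha'}p_{\alpha'\alpha''}=p_{\alpha\alpha''}$. It is $G$-movable (equivariantly movable) if for every $\alpha\in A$ there is $\alpha'\ge\alpha$ such that for all $\alpha''\ge\alpha$ there is a $G$-homotopy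 class $r^{\alpha'\alpha''}:X_{\alpha'}\to X_{\alpha''}$ with $p_{\alpha\alpha''}\circ r^{\alpha'\alpha''}=p_{\alpha\alpha'}$. An inverse $G$-$ANR$-system (one whose terms are $G$-$ANR$'s) is associated with $X$ (in the sense of Morita; equivalently, it is a $G$-$ANR$-expansion of $X$) if there are $G$-homotopy classes $p_\alpha:X\to X_\alpha$ with $p_\alpha=p_{\alpha\alpha'}p_{\alpha'}$ for $\alpha\le\alpha'$ such that for every $G$-$ANR$ $K$: (i) each $G$-homotopy class $h:X\to K$ has the form $h=f p_\alpha$ for some $\alpha$ and some $G$-homotopy class $f:X_\alpha\to K$; (ii) if $f,f':X_\alpha\to K$ are $G$-homotopy classes with $fp_\alpha=f'p_\alpha$, then $fp_{\alpha\alpha'}=f'p_{\alpha\alpha'}$ for some $\alpha'\ge\alpha$. A $G$-space $X$ is $G$-movable (equivariantly movable) if there is a $G$-movable inverse $G$-$ANR$-system associated with $X$. $H$-movability is the same notion with $H$ in place of $G$. *)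

(* Defs.v *)
From HB Require Import structures.
From mathcomp Require Import all_boot all_order all_algebra.
From mathcomp Require Import all_classical all_reals all_analysis.
Import numFieldNormedType.Exports.

Set Implicit Arguments.
Unset Strict Implicit.
Unset Printing Implicit Defensive.

Local Open Scope classical_set_scope.

HB.mixin Record isTopologicalGroup G of Topological G & Group G := {
  mulg_continuous : continuous (fun gh : G * G => (gh.1 * gh.2)%g);
  invg_continuous : continuous (fun g : G => (g^-1)%g)
}.

#[short(type="topologicalGroupType")]
HB.structure Definition TopologicalGroup :=
  {G of Topological G & Group G & isTopologicalGroup G}.

Record closed_subgroup (G : topologicalGroupType) := ClosedSubgroup {
  csg_set :> set G;
  csg_closed : closed csg_set;
  csg_one : csg_set 1%g;
  csg_mul : forall g h, csg_set g -> csg_set h -> csg_set (g * h)%g;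
  csg_inv : forall g, csg_set g -> csg_set (g^-1)%g
}.

(** A closed subgroup, with the subspace topology and the restricted
    operations, is a topological group in its own right. *)
Section subgroup_type.
Context (G : topologicalGroupType) (H : closed_subgroup G).

Definition subgroup_type : Type := set_type H.
HB.instance Definition _ := Topological.copy subgroup_type (set_type H).

Definition subgroup_val (h : subgroup_type) : G := set_val h.

Lemma subgroup_valP (h : subgroup_type) : csg_set H (subgroup_val h).
Proof. exact: set_valP. Qed.

Lemma subgroup_val_inj : injective subgroup_val.
Proof. exact: val_inj. Qed.

Definition subgroup_mul (g h : subgroup_type) : subgroup_type :=
  SigSub (mem_set (csg_mul (subgroup_valP g) (subgroup_valP h))).
Definition subgroup_one : subgroup_type := SigSub (mem_set (csg_one H)).
Definition subgroup_inv (h : subgroup_type) : subgroup_type :=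
  SigSub (mem_set (csg_inv (subgroup_valP h))).

Let mulA : associative subgroup_mul.
Proof. by move=> x y z; apply: subgroup_val_inj; exact: mulgA. Qed.
Let mul1 : left_id subgroup_one subgroup_mul.
Proof. by move=> x; apply: subgroup_val_inj; exact: mul1g. Qed.
Let mulr1 : right_id subgroup_one subgroup_mul.
Proof. by move=> x; apply: subgroup_val_inj; exact: mulg1. Qed.
Let mulV : left_inverse subgroup_one subgroup_inv subgroup_mul.
Proof. by move=> x; apply: subgroup_val_inj; exact: mulVg. Qed.
Let mulrV : right_inverse subgroup_one subgroup_inv subgroup_mul.
Proof. by move=> x; apply: subgroup_val_inj; exact: mulgV. Qed.

HB.instance Definition _ :=
  isGroup.Build subgroup_type mulA mul1 mulr1 mulV mulrV.

Lemma subgroup_val_continuous : continuous subgroup_val.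
Proof. exact: initial_continuous. Qed.

Lemma continuous_into_subgroup (T : topologicalType) (f : T -> subgroup_type) :
  continuous (subgroup_val \o f) -> continuous f.
Proof.
move=> cf x A [B [[C oC CB] Bfx BA]].
apply: (filterS BA); apply: (filterS (P := f @^-1` B)) => //.
rewrite -CB; apply: cf; apply: open_nbhs_nbhs; split=> //.
by move: Bfx; rewrite -CB.
Qed.

Let mul_cont : continuous (fun gh : subgroup_type * subgroup_type =>
  (gh.1 * gh.2)%g).
Proof.
apply: continuous_into_subgroup => x.
apply: (@continuous_comp _ _ _
  (fun gh : subgroup_type * subgroup_type =>
     (subgroup_val gh.1, subgroup_val gh.2))
  (fun gh : G * G => (gh.1 * gh.2)%g)); last exact: mulg_continuous.
by apply: cvg_pair;
  [apply: (cvg_comp _ _ cvg_fst) | apply: (cvg_comp _ _ cvg_snd)];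
  exact: subgroup_val_continuous.
Qed.

Let inv_cont : continuous (fun g : subgroup_type => (g^-1)%g).
Proof.
apply: continuous_into_subgroup => x.
apply: (@continuous_comp _ _ _ subgroup_val (fun g : G => (g^-1)%g)).
  exact: subgroup_val_continuous.
exact: invg_continuous.
Qed.

HB.instance Definition _ :=
  isTopologicalGroup.Build subgroup_type mul_cont inv_cont.

End subgroup_type.

Record gspace (G : topologicalGroupType) := GSpace {
  gspace_sort :> topologicalType;
  gact : G -> gspace_sort -> gspace_sort;
  gact1 : forall x, gact 1%g x = x;
  gactM : forall g h x, gact (g * h)%g x = gact g (gact h x);
  gact_continuous : continuous (fun gx : G * gspace_sort => gact gx.1 gx.2)
}.

Record gmap (G : topologicalGroupType) (X Y : gspace G) := GMap {
  gmap_fun :> X -> Y;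
  gmap_continuous : continuous gmap_fun;
  gmap_equivariant : forall g x, gmap_fun (gact g x) = gact g (gmap_fun x)
}.

Definition gid (G : topologicalGroupType) (X : gspace G) : gmap X X :=
  @GMap G X X idfun (fun x => cvg_id) (fun _ _ => erefl).

Section gcomp.
Context (G : topologicalGroupType) (X Y Z : gspace G).
Context (f : gmap Y Z) (e : gmap X Y).

Let comp_cont : continuous (f \o e).
Proof.
by move=> x; apply: continuous_comp;
  [exact: gmap_continuous | exact: gmap_continuous].
Qed.

Let comp_equivariant g x : (f \o e) (gact g x) = gact g ((f \o e) x).
Proof. by rewrite /= !gmap_equivariant. Qed.

Definition gcomp : gmap X Z := GMap comp_cont comp_equivariant.
End gcomp.

Section restriction.
Context (G : topologicalGroupType) (H : closed_subgroup G) (X : gspace G).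

Let res_act (h : subgroup_type H) (x : X) : X := gact (subgroup_val h) x.

Let res_act1 x : res_act 1%g x = x.
Proof. exact: gact1. Qed.

Let res_actM g h x : res_act (g * h)%g x = res_act g (res_act h x).
Proof. exact: gactM. Qed.

Let res_act_continuous :
  continuous (fun hx : subgroup_type H * X => res_act hx.1 hx.2).
Proof.
move=> x.
apply: (@continuous_comp _ _ _
  (fun hx : subgroup_type H * X => (subgroup_val hx.1, hx.2))
  (fun gx : G * X => gact gx.1 gx.2)); last exact: gact_continuous.
apply: cvg_pair; last exact: cvg_snd.
by apply: (cvg_comp _ _ cvg_fst); exact: subgroup_val_continuous.
Qed.

(** [X] as an [H]-space. *)
Definition gspace_restrict : gspace (subgroup_type H) :=
  GSpace res_act1 res_actM res_act_continuous.
End restriction.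

Definition closed_map (X Y : topologicalType) (f : X -> Y) : Prop :=
  forall A : set X, closed A -> closed (f @` A).

Definition perfect_surjection (X Y : topologicalType) (f : X -> Y) : Prop :=
  [/\ continuous f, closed_map f, (forall y, compact (f @^-1` [set y]))
    & range f = [set: Y]].

Section GANR.
Variable R : realType.

(** Paracompact p-spaces (Arhangel'skii): the Hausdorff spaces that admit a
    perfect map onto a metrizable space. *)
Definition p_paracompact (X : topologicalType) : Prop :=
  hausdorff_space X /\
  exists (M : metricType R) (f : X -> M), perfect_surjection f.

Section fixed_group.
Variable G : topologicalGroupType.

Definition ghomotopic (X Y : gspace G) (f0 f1 : gmap X Y) : Prop :=
  exists F : X * set_type (`[0%R, 1%R] : set R) -> Y,
    [/\ continuous F,
        forall g x t, F (gact g x, t) = gact g (F (x, t)),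
        forall x t, set_val t = 0%R -> F (x, t) = f0 x
      & forall x t, set_val t = 1%R -> F (x, t) = f1 x].

(** "[Y] is a closed invariant subset of [Z]" is rendered by an equivariant
    closed embedding [i] of [Y] into [Z].  The retraction is defined on the
    subtype [set_type U] (rather than being a total function on [Z]) so that the
    empty [G]-space is not excluded. *)
Definition GANR (Y : gspace G) : Prop :=
  p_paracompact Y /\
  forall (Z : gspace G) (i : gmap Y Z),
    p_paracompact Z -> injective i -> closed_map i ->
    exists U : set Z,
      [/\ range i `<=` U°,
          forall g z, U z -> U (gact g z)
        & exists r : set_type U -> Y,
          [/\ continuous r,
              forall g (u v : set_type U),
                set_val v = gact g (set_val u) -> r v = gact g (r u)
            & forall y (u : set_type U), set_val u = i y -> r u = y]].

(** Homotopy classes are handled through representatives: the bonding classes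
    are given by chosen [G]-maps, and every equation between classes becomes a
    [ghomotopic] relation between representatives. *)
Record gsystem := GSystem {
  gs_idx : Type;
  gs_le : gs_idx -> gs_idx -> Prop;
  gs_inhabited : inhabited gs_idx;
  gs_refl : forall a, gs_le a a;
  gs_trans : forall a b c, gs_le a b -> gs_le b c -> gs_le a c;
  gs_directed : forall a b, exists c, gs_le a c /\ gs_le b c;
  gs_obj :> gs_idx -> gspace G;
  gs_bond : forall a b, gs_le a b -> gmap (gs_obj b) (gs_obj a);
  gs_bond_id : forall a (le_aa : gs_le a a),
    ghomotopic (gs_bond le_aa) (gid (gs_obj a));
  gs_bond_comp : forall a b c (le_ab : gs_le a b) (le_bc : gs_le b c)
      (le_ac : gs_le a c),
    ghomotopic (gcomp (gs_bond le_ab) (gs_bond le_bc)) (gs_bond le_ac)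
}.

Definition gmovable_system (S : gsystem) : Prop :=
  forall a : gs_idx S, exists (b : gs_idx S) (le_ab : gs_le a b),
    forall (c : gs_idx S) (le_ac : gs_le a c),
      exists r : gmap (S b) (S c),
        ghomotopic (gcomp (gs_bond le_ac) r) (gs_bond le_ab).

Definition associated (X : gspace G) (S : gsystem) : Prop :=
  exists p : forall a, gmap X (S a),
    (forall a b (le_ab : gs_le a b),
       ghomotopic (p a) (gcomp (gs_bond le_ab) (p b))) /\
    forall K : gspace G, GANR K ->
      (forall h : gmap X K, exists a (f : gmap (S a) K),
         ghomotopic h (gcomp f (p a))) /\
      (forall a (f f' : gmap (S a) K),
         ghomotopic (gcomp f (p a)) (gcomp f' (p a)) ->
         exists b (le_ab : gs_le a b),
           ghomotopic (gcomp f (gs_bond le_ab)) (gcomp f' (gs_bond le_ab))).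

Definition gmovable (X : gspace G) : Prop :=
  exists S : gsystem,
    [/\ forall a, GANR (S a), associated X S & gmovable_system S].

End fixed_group.
End GANR.

(* Main.v *)
Require Import Defs.
From HB Require Import structures.
From mathcomp Require Import all_boot all_order all_algebra.
From mathcomp Require Import all_classical all_reals all_analysis.
From mathcomp Require Import wochoice ring lra.
Import Order.TTheory GRing.Theory Num.Theory.
Import numFieldNormedType.Exports.

Set Implicit Arguments.
Unset Strict Implicit.
Unset Printing Implicit Defensive.

Local Open Scope classical_set_scope.
Local Open Scope ring_scope.

(* Call a G-space Z an equivariant absolute extensor if, for every compact
   group H and continuous homomorphism H -> G, every H-map to Z from a closed
   invariant subset of a p-paracompact H-space extends.  The key point is that
   every p-paracompact G-space embeds as a closed subset of a p-paracompact Z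
   with this property, for all H at once.  No Haar measure is needed: Z consists
   of families of [0,1]-valued functions on G, on which G acts by right
   translation, so an H-map E -> Z is a family of functions on E x G invariant
   under h.(x, g) = (hx, gh^-1).  Such families are extended by
   F(v) = sup_u (f(u) - D(v, u)) for an invariant continuous pseudometric D
   dominating f; this sup-convolution preserves invariance, and D exists because
   E x G is paracompact.  Z is a product of a compact cube of functions that are
   Lipschitz along G (separating points) and of a metrizable space (carrying a
   perfect map from X).

   Hence G-ANR's are H-ANR's.  Moreover X has, in each product Z x S_a, arbitrarily
   small neighborhoods W that are G-ANR's, even among H-invariant neighborhoods.
   An H-map (or H-homotopy) from X to an H-ANR extends to such a W, and X -> W
   factors through the system S up to G-homotopy; so S restricted to H is
   associated with X as an H-space, and it is clearly H-movable. *)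

(** * Perfect maps and paracompact p-spaces *)

(** The test spaces [K] for the restricted space carry only an [H]-action, so the universal
    properties of [S] do not apply to them. They are applied to the neighborhoods [W] instead, which
    are [G]-spaces on which an extended [H]-map is still defined. The factor [S a] is there for the
    uniqueness clause: two [H]-maps out of [S a] pull back to all of [Z x S a] along the projection,
    so a homotopy between their restrictions to [X] becomes an extension problem inside that
    product. Two kinds of factors occur in [Z] because a p-paracompact space need not embed in a
    metrizable one. The metrizable factor makes the image of [X] closed, the compact factor makes
    the map injective. Suprema over a compact group do the work of averages: they preserve
    continuity, Lipschitz bounds and bounds by 1, and they produce invariance. The price is that
    everything is phrased through functions into [0,1] and pseudometrics bounded by 1. *)

Section psup.
Context {R : realType} {I : Type}.
Implicit Types (P : set I) (f g : I -> R).

(* Adjoining [0] makes [psup] nonnegative even when [P] is empty; it is a junk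
   value when [f] is unbounded. *)
Definition psup P f : R := sup ([set 0] `|` f @` P).

Lemma psup_ub P f i : (forall i, P i -> f i <= 1) -> P i -> f i <= psup P f.
Proof.
move=> f1 Pi; apply: ub_le_sup; last by right; exists i.
by exists 1 => _ [->|[j Pj <-]]; [exact: ler01|exact: f1].
Qed.

Lemma psup_le P f c : 0 <= c -> (forall i, P i -> f i <= c) -> psup P f <= c.
Proof.
move=> c0 fc; apply: ge_sup; first by exists 0; left.
by move=> _ [->|[i Pi <-]] //; exact: fc.
Qed.

Lemma psup_ge0 P f : 0 <= psup P f.
Proof.
have [[u uP]|nb] := pselect (has_ubound ([set 0] `|` f @` P)).
  by apply: ub_le_sup; [exists u|left].
by rewrite /psup sup_out // => -[].
Qed.

Lemma psup_gt P f c : 0 <= c -> c < psup P f -> exists2 i, P i & c < f i.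
Proof.
move=> c0 cs; apply: contrapT => h.
have : psup P f <= c.
  apply: psup_le => // i Pi; rewrite leNgt; apply/negP => cf.
  by apply: h; exists i.
by rewrite leNgt cs.
Qed.

Lemma psup_dist P f g e : (forall i, P i -> f i <= 1) ->
  (forall i, P i -> g i <= 1) -> 0 <= e ->
  (forall i, P i -> `|f i - g i| <= e) -> `|psup P f - psup P g| <= e.
Proof.
move=> f1 g1 e0 fg.
rewrite ler_distlC; apply/andP; split.
  rewrite lerBlDr; apply: psup_le; first by rewrite addr_ge0 // psup_ge0.
  move=> i Pi; have := fg i Pi; have := psup_ub g1 Pi.
  by rewrite ler_norml => ? /andP[? ?]; lra.
apply: psup_le; first by rewrite addr_ge0 // psup_ge0.
move=> i Pi; have := fg i Pi; have := psup_ub f1 Pi.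
by rewrite ler_norml => ? /andP[? ?]; lra.
Qed.

End psup.

Section perfect.

(** Surjectivity is dropped from [perfect_surjection] so that closed embeddings are included;
    [p_paracompactE] shows that the class of spaces does not change. *)
Definition perfect_map (X Y : topologicalType) (f : X -> Y) : Prop :=
  [/\ continuous f, closed_map f & forall y, compact (f @^-1` [set y])].

Context {X Y : topologicalType} (f : X -> Y).

(** The images of closures of members of [F] are closed and adhere to [y], so these closures all
    meet the fibre over [y]. Compactness of the fibre gives a common cluster point, which is a limit
    because [F] is an ultrafilter. *)
Lemma perfect_map_ultra (F : set_system X) y : perfect_map f ->
  UltraFilter F -> f @ F --> y -> exists2 x, f x = y & F --> x.
Proof.
move=> [cf clf kf] FU Fy.
have FF : ProperFilter F by exact: ultra_proper.
pose G := filter_from F (fun A => closure A `&` f @^-1` [set y]).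
have FG : ProperFilter G.
  apply: filter_from_proper.
    apply: filter_from_filter; first by exists setT; exact: filterT.
    move=> A B FA FB; exists (A `&` B); first exact: filterI.
    by move=> x [cx fx]; split; split => //; move: x cx {fx}; apply: closureS;
      [exact: subIsetl|exact: subIsetr].
  move=> A FA.
  have : closure (f @` closure A) y.
    move=> V nV; have FV : F (f @^-1` V) := Fy _ nV.
    have [x [Ax Vx]] := filter_ex (filterI FA FV).
    by exists (f x); split => //; exists x => //; exact: subset_closure.
  have /closure_id <- := clf _ (closed_closure (A := A)).
  by case=> x Ax fx; exists x.
have GK : G (f @^-1` [set y]) by exists setT; [exact: filterT|move=> ? []].
have [x [fx xG]] := kf y G FG GK.
exists x => //.
rewrite -[_ --> x]/([set _ | _] x) -ultra_cvg_clusterE => A B FA nB.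
have GA : G (closure A `&` f @^-1` [set y]) by exists A.
have [z [[cz _] Bz]] := xG _ _ GA (nbhs_interior nB).
have [w [Aw Bw]] := cz _ Bz.
by exists w.
Qed.

(** The converse of [perfect_map_ultra]. Lifting of ultrafilter limits is the form of perfectness
    that passes to composites, pairs and products. *)
Lemma ultra_perfect_map : continuous f ->
  (forall F : set_system X, UltraFilter F -> forall y, f @ F --> y ->
     exists2 x, f x = y & F --> x) -> perfect_map f.
Proof.
move=> cf H; split => //.
  move=> A clA; apply/closure_id; rewrite eqEsubset; split.
    exact: subset_closure.
  move=> y cy.
  pose G := filter_from (nbhs y) (fun V => A `&` f @^-1` V).
  have FG : ProperFilter G.
    apply: filter_from_proper.
      apply: filter_from_filter; first by exists setT; exact: filterT.
      move=> V W nV nW; exists (V `&` W); first exact: filterI.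
      by move=> x [Ax [Vx Wx]].
    by move=> V /cy [_ [[x Ax <-] Vx]]; exists x.
  have [F [FU GF]] := ultraFilterLemma FG.
  have Fy : f @ F --> y.
    by move=> V nV; apply: GF; exists V => // x [].
  have [x fx Fx] := H F FU y Fy.
  exists x => //; have -> : A = closure A by apply/closure_id.
  have FA : F A by apply: GF; exists setT; [exact: filterT|move=> ? []].
  have FF : ProperFilter F by exact: ultra_proper.
  move=> B nB; have FB : F B := Fx _ nB.
  by have [z [Az Bz]] := filter_ex (filterI FA FB); exists z.
move=> y; rewrite compact_ultra => F FU FA.
have FF : ProperFilter F by exact: ultra_proper.
have Fy : f @ F --> y.
  by move=> V /nbhs_singleton nV; apply: filterS FA => x /= ->.
by have [x fx Fx] := H F FU y Fy; exists x.
Qed.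

End perfect.

Lemma ultra_fmap (X Y : Type) (f : X -> Y) (F : set_system X) :
  UltraFilter F -> UltraFilter (f @ F).
Proof.
move=> FU; have FF : ProperFilter F by exact: ultra_proper.
split; first exact: fmap_proper_filter.
move=> G PG FG; apply/seteqP; split; last exact: FG.
move=> A GA; have [FA|FA] := in_ultra_setVsetC (f @^-1` A) FU; first by [].
have : G (A `&` ~` A) by apply: filterI => //; exact: FG.
by rewrite setICr => /filter_ex [].
Qed.

Lemma perfect_map_comp (X Y Z : topologicalType) (f : X -> Y) (g : Y -> Z) :
  perfect_map f -> perfect_map g -> perfect_map (g \o f).
Proof.
move=> pf pg; apply: ultra_perfect_map.
  by move=> x; apply: continuous_comp; [case: pf => + _ _|case: pg => + _ _];
    exact.
move=> F FU z Fz.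
have FF : ProperFilter F by exact: ultra_proper.
have UfF : UltraFilter (f @ F) by exact: ultra_fmap.
have [y gy Fy] := perfect_map_ultra pg UfF Fz.
have [x fx Fx] := perfect_map_ultra pf FU Fy.
by exists x => //=; rewrite fx.
Qed.

(** * Metrics on subspaces and products *)

Section set_type_metric.
Context (R : realType) (M : metricType R) (A : set M).

Let sdist (x y : A) : R := mdist (set_val x) (set_val y).

Let sdist_ge0 x y : 0 <= sdist x y.
Proof. exact: mdist_ge0. Qed.

Let sdist_positivity x y : sdist x y = 0 -> x = y.
Proof. by move=> /(@mdist_positivity R M) xy; exact: val_inj. Qed.

Let sdist_ball (x : A) d : ball x d = [set y | sdist x y < d].
Proof.
by rewrite /ball /= /initial_ball ballEmdist.
Qed.

HB.instance Definition _ := @PseudoMetric_isMetric.Build R (A : Type) sdist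
  sdist_ge0 sdist_positivity sdist_ball.

End set_type_metric.

Section prod_metric.
Context (R : realType) (M N : metricType R).

Let pdist (x y : M * N) : R := Num.max (mdist x.1 y.1) (mdist x.2 y.2).

Let pdist_ge0 x y : 0 <= pdist x y.
Proof. by rewrite /pdist le_max mdist_ge0. Qed.

Let pdist_positivity x y : pdist x y = 0 -> x = y.
Proof.
move=> xy; have : pdist x y <= 0 by rewrite xy.
rewrite /pdist ge_max => /andP[h1 h2].
rewrite [x]surjective_pairing [y]surjective_pairing.
by congr (_, _); apply: (@mdist_positivity R); apply/eqP;
  rewrite eq_le mdist_ge0 ?h1 ?h2.
Qed.

Let pdist_ball x d : ball x d = [set y | pdist x y < d].
Proof.
apply/seteqP; split => y; rewrite /= /pdist gt_max.
  by case; rewrite !ballEmdist /= => -> ->.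
by case/andP => *; split; rewrite ballEmdist.
Qed.

HB.instance Definition _ := @PseudoMetric_isMetric.Build R (M * N)%type pdist
  pdist_ge0 pdist_positivity pdist_ball.

End prod_metric.

Lemma fst_continuous (X Y : topologicalType) : continuous (@fst X Y).
Proof. by move=> x; exact: cvg_fst. Qed.

Lemma snd_continuous (X Y : topologicalType) : continuous (@snd X Y).
Proof. by move=> x; exact: cvg_snd. Qed.

Lemma continuous_compose (X Y Z : topologicalType) (f : X -> Y) (g : Y -> Z) :
  continuous f -> continuous g -> continuous (g \o f).
Proof. by move=> cf cg x; apply: continuous_comp; [exact: cf|exact: cg]. Qed.

Lemma continuous_pair (X Y Z : topologicalType) (f : X -> Y) (g : X -> Z) :
  continuous f -> continuous g -> continuous (fun x => (f x, g x)).
Proof. by move=> cf cg x; apply: cvg_pair; [exact: cf|exact: cg]. Qed.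

Lemma set_val_continuous (X : topologicalType) (A : set X) :
  continuous (set_val : A -> X).
Proof. exact: (@initial_continuous A X set_val). Qed.

Lemma continuous_to_set_type (X Y : topologicalType) (A : set Y)
  (f : X -> A) : continuous (set_val \o f) -> continuous f.
Proof. exact: (@continuous_comp_initial A X Y set_val f). Qed.

Lemma preimage_closedT (X Y : topologicalType) (f : X -> Y) (A : set Y) :
  continuous f -> closed A -> closed (f @^-1` A).
Proof. by move=> cf; apply: preimage_closed => x _; exact: cf. Qed.

Lemma cvg_prodP (X Y : topologicalType) (F : set_system (X * Y)%type)
  (x : X) (y : Y) :
  Filter F -> F --> (x, y) <-> fst @ F --> x /\ snd @ F --> y.
Proof.
move=> FF; split => [Fxy|[Fx Fy]].
  split.
    exact: (cvg_comp _ fst Fxy (@cvg_fst X Y (nbhs x) (nbhs y) _)).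
  exact: (cvg_comp _ snd Fxy (@cvg_snd X Y (nbhs x) (nbhs y) _)).
have -> : F = (fun z => (z.1, z.2)) @ F.
  by apply/funext => A; congr (F _); apply/funext => -[].
exact: cvg_pair.
Qed.

Lemma hausdorff_cvg_unique (T : topologicalType) (F : set_system T)
  (x y : T) :
  hausdorff_space T -> ProperFilter F -> F --> x -> F --> y -> x = y.
Proof. by move=> hT FF; apply: cvg_unique. Qed.

Lemma hausdorff_inj (X Y : topologicalType) (f : X -> Y) : hausdorff_space Y ->
  continuous f -> injective f -> hausdorff_space X.
Proof.
move=> hY cf fI p q pq; apply/fI/hY => A B nA nB.
by have [z [Az Bz]] := pq _ _ (cf _ _ nA) (cf _ _ nB); exists (f z).
Qed.

Lemma hausdorff_prod (X Y : topologicalType) : hausdorff_space X ->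
  hausdorff_space Y -> hausdorff_space (X * Y)%type.
Proof.
move=> hX hY [x y] [x' y'] pq; congr (_, _).
  apply: hX => A B nA nB.
  have [] := pq (A `*` setT) (B `*` setT).
  - by exists (A, setT) => //; split => //; exact: filterT.
  - by exists (B, setT) => //; split => //; exact: filterT.
  by move=> z [[Az _] [Bz _]]; exists z.1.
apply: hY => A B nA nB.
have [] := pq (setT `*` A) (setT `*` B).
- by exists (setT, A) => //; split => //; exact: filterT.
- by exists (setT, B) => //; split => //; exact: filterT.
by move=> z [[_ Az] [_ Bz]]; exists z.2.
Qed.

Lemma perfect_map_closed_embedding (X Y : topologicalType) (f : X -> Y) :
  continuous f -> closed_map f -> injective f -> perfect_map f.
Proof.
move=> cf clf fI; split => // y.
have [[x fx]|nf] := pselect (exists x, f x = y).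
  suff -> : f @^-1` [set y] = [set x] by exact: compact_set1.
  by apply/seteqP; split => z /=; [rewrite -fx => /fI|move=> ->].
suff -> : f @^-1` [set y] = set0 by exact: compact0.
by apply/seteqP; split => // z fz; apply: nf; exists z.
Qed.

Lemma perfect_map_fst (X Y : topologicalType) :
  compact [set: Y] -> perfect_map (@fst X Y).
Proof.
move=> cY; apply: ultra_perfect_map; first by move=> x; exact: cvg_fst.
move=> F FU x Fx; have FF : ProperFilter F by exact: ultra_proper.
have UF : UltraFilter (snd @ F) by exact: ultra_fmap.
move: cY; rewrite compact_ultra => /(_ _ UF) [].
  exact: filterT.
by move=> y [_ Fy]; exists (x, y) => //; apply/cvg_prodP.
Qed.

(** The first coordinate alone lifts limits, and Hausdorffness of [Z] identifies the limit of the
    second with the value of [g]. Hence a perfect map can be made injective by adding separating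
    coordinates while staying closed. *)
Lemma perfect_map_pair (X Y Z : topologicalType) (f : X -> Y) (g : X -> Z) :
  hausdorff_space Z -> perfect_map f -> continuous g ->
  perfect_map (fun x => (f x, g x)).
Proof.
move=> hZ pf cg; have [cf _ _] := pf; apply: ultra_perfect_map.
  by move=> x; apply: cvg_pair; [exact: cf|exact: cg].
move=> F FU [y z] Fyz; have FF : ProperFilter F by exact: ultra_proper.
have /cvg_prodP [Fy Fz] := Fyz.
have [x fx Fx] := perfect_map_ultra pf FU Fy.
exists x => //; rewrite fx; congr (_, _).
apply: (@hausdorff_cvg_unique _ (g @ F)) => //.
exact: (cvg_comp _ _ Fx (cg x)).
Qed.

Lemma perfect_map_prod (X Y X' Y' : topologicalType) (f : X -> Y)
  (f' : X' -> Y') : perfect_map f -> perfect_map f' ->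
  perfect_map (fun x => (f x.1, f' x.2)).
Proof.
move=> pf pf'; have [cf _ _] := pf; have [cf' _ _] := pf'.
apply: ultra_perfect_map.
  apply: continuous_pair.
    exact: (continuous_compose (@fst_continuous _ _) cf).
  exact: (continuous_compose (@snd_continuous _ _) cf').
move=> F FU [y z] Fyz; have FF : ProperFilter F by exact: ultra_proper.
have /cvg_prodP [Fy Fz] := Fyz.
have [x fx Fx] := perfect_map_ultra pf (ultra_fmap fst FU) Fy.
have [x' fx' Fx'] := perfect_map_ultra pf' (ultra_fmap snd FU) Fz.
by exists (x, x'); [rewrite fx fx'|apply/cvg_prodP].
Qed.

Section p_paracompact.
Context {R : realType}.

(** A perfect map corestricts to a perfect surjection onto its range, a subspace of a metric
    space. *)
Lemma p_paracompactE (X : topologicalType) : p_paracompact R X <->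
  hausdorff_space X /\ exists (M : metricType R) (f : X -> M), perfect_map f.
Proof.
split => [[hX [M [f [cf clf kf _]]]]|[hX [M [f [cf clf kf]]]]].
  by split => //; exists M, f.
split => //.
pose N : metricType R := set_type (range f).
have rf x : f x \in range f by rewrite inE; exists x.
pose g (x : X) : N := SigSub (rf x).
have gE x : set_val (g x) = f x by [].
have cg : continuous g.
  by apply: continuous_to_set_type => x; exact: cf.
exists N, g; split => //.
- move=> A clA; have -> : g @` A = set_val @^-1` (f @` A).
    apply/seteqP; split => [_ [x Ax <-]|y /= [x Ax fx]]; first by exists x.
    by exists x => //; apply: val_inj.
  by apply: preimage_closedT; [exact: set_val_continuous|exact: clf].
- move=> y; have -> : g @^-1` [set y] = f @^-1` [set set_val y]; last exact: kf.
  apply/seteqP; split => x /=; first by move=> <-.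
  by move=> fx; exact: val_inj.
apply/seteqP; split => // y _.
have [x _ fx] := set_valP y; exists x => //; exact: val_inj.
Qed.

Lemma p_paracompact_perfect (X Y : topologicalType) (f : X -> Y) :
  hausdorff_space X -> perfect_map f -> p_paracompact R Y -> p_paracompact R X.
Proof.
move=> hX pf /p_paracompactE[hY [M [g pg]]]; apply/p_paracompactE; split => //.
by exists M, (g \o f); exact: perfect_map_comp.
Qed.

Lemma p_paracompact_metric (M : metricType R) : p_paracompact R M.
Proof.
apply/p_paracompactE; split; first exact: metric_hausdorff.
exists M, idfun; apply: perfect_map_closed_embedding.
- by move=> x; exact: cvg_id.
- by move=> A; rewrite image_id.
- by move=> ? ?.
Qed.

Lemma p_paracompact_prod (X Y : topologicalType) :
  p_paracompact R X -> p_paracompact R Y -> p_paracompact R (X * Y)%type.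
Proof.
move=> /p_paracompactE[hX [M [f pf]]] /p_paracompactE[hY [N [g pg]]].
apply/p_paracompactE; split; first exact: hausdorff_prod.
by exists (M * N)%type, (fun x => (f x.1, g x.2)); exact: perfect_map_prod.
Qed.

Lemma p_paracompact_prod_compact (X Y : topologicalType) :
  p_paracompact R X -> hausdorff_space Y -> compact [set: Y] ->
  p_paracompact R (X * Y)%type.
Proof.
move=> pX hY cY; apply: p_paracompact_perfect (perfect_map_fst _ cY) (pX).
by apply: hausdorff_prod => //; case: pX.
Qed.

End p_paracompact.

(** * Normality and partitions *)

Section stone.
Context {R : realType} (M : metricType R) (r : M -> R).
Hypothesis r_gt0 : forall m, 0 < r m.
Hypothesis r_le1 : forall m, r m <= 1.

(* M. E. Rudin's proof that metrizable spaces are paracompact, with functions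
   in place of open sets. *)
Lemma sigma_discrete_bumps : exists (c : nat -> R) (bump : nat -> M -> M -> R),
  [/\ (forall n, 0 < c n <= 1) /\
        (forall e, 0 < e -> exists N, forall n, (N <= n)%N -> c n < e),
      (forall n m x, 0 <= bump n m x <= c n) /\
        (forall n m x y, `|bump n m x - bump n m y| <= mdist x y),
      forall n m x, 0 < bump n m x -> mdist m x <= r m - c n,
      forall n m m' x y, 0 < bump n m x -> 0 < bump n m' y ->
        mdist x y < c n -> m = m'
    & forall x, exists n m, 0 < bump n m x].
Proof.
have [lt woP] := well_ordering_principle M.
(* The depth of [x] in the ball of radius [r m] about [m]. Below, [g x m] is the greatest depth in a
   ball whose center comes earlier in the well-ordering. *)
pose f x m := Num.max 0 (r m - mdist m x).
have f_ge0 x m : 0 <= f x m by rewrite /f le_max lexx.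
have f_le1 x m : f x m <= 1.
  rewrite /f ge_max ler01 /=.
  by have := mdist_ge0 m x; have := r_le1 m; lra.
have fD x y m : f x m <= f y m + mdist x y.
  rewrite {1}/f ge_max; apply/andP; split.
    by rewrite addr_ge0 // mdist_ge0.
  have : r m - mdist m y <= f y m by rewrite /f le_max lexx orbT.
  by have := metric_triangle m x y; lra.
pose P m := [set m' | lt m' m /\ m' <> m].
pose g x m := psup (P m) (f x).
have gD x y m : g x m <= g y m + mdist x y.
  apply: psup_le; first by rewrite addr_ge0 ?psup_ge0 ?mdist_ge0.
  move=> m' Pm'; apply: le_trans (fD x y m') _; rewrite lerD2r.
  by apply: psup_ub.
pose c n : R := n.+1%:R^-1.
have c_gt0 n : 0 < c n by rewrite invr_gt0 ltr0n.
(* Positive when [x] is deeper than [2 * c n] in the ball of [m] and less deep than [c n] in all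
   earlier balls. The gap [c n] between the two thresholds separates the supports of different
   [m]. *)
pose b n m x := Num.max 0 (Num.min (f x m - 2 * c n) (c n - g x m)).
have b_gt0 n m x : 0 < b n m x -> 2 * c n < f x m /\ g x m < c n.
  by rewrite /b lt_max ltxx /= lt_min => /andP[? ?]; split; lra.
have bD n m x y : b n m x <= b n m y + mdist x y.
  rewrite {1}/b ge_max; apply/andP; split.
    by rewrite addr_ge0 ?mdist_ge0 // /b le_max lexx.
  have h : Num.min (f y m - 2 * c n) (c n - g y m) <= b n m y.
    by rewrite /b le_max lexx orbT.
  have h1 := fD x y m; have h2 := gD y x m.
  rewrite [mdist y x]metric_sym in h2.
  rewrite ge_min; move: h.
  by case: (leP (f y m - 2 * c n) (c n - g y m)) => h h3; apply/orP;
    [left|right]; lra.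
exists c, b; split; [split|split| | |].
- by move=> n; rewrite c_gt0 /= invf_le1 ?ler1n ?ltr0n.
- move=> e e0; have [N _ NP] := near_infty_natSinv_lt (PosNum e0).
  by exists N => n /NP.
- move=> n m x; rewrite /b le_max lexx /= ge_max ltW ?c_gt0 //= ge_min.
  by have := psup_ge0 (P m) (f x); rewrite -/(g x m) => ?;
    apply/orP; right; lra.
- move=> n m x y; rewrite ler_norml.
  have := bD n m x y; have := bD n m y x; rewrite [mdist y x]metric_sym.
  by move=> ? ?; apply/andP; split; lra.
- move=> n m x /b_gt0[+ _]; rewrite /f lt_max => /orP[|].
    by have := c_gt0 n; lra.
  by have := c_gt0 n; lra.
- have aux n m m' x y : 0 < b n m x -> 0 < b n m' y ->
      mdist x y < c n -> lt m m' -> m = m'.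
    move=> /b_gt0[fm _] /b_gt0[_ gm] xy mm'; apply: contrapT => nmm'.
    have : f y m <= g y m' by apply: psup_ub => //; split.
    by have := fD x y m; lra.
  move=> n m m' x y bx by' xy.
  have [z [[zA zlb] _]] : exists! z, minimum_of lt (pred2 m m') z.
    by apply: woP; exists m; rewrite inE eqxx.
  have [zm|zm'] : lt m m' \/ lt m' m.
    move: zA; rewrite inE => /orP[|] /eqP zE; rewrite -{1}zE.
      by left; apply: zlb; rewrite inE eqxx orbT.
    by right; rewrite -zE; apply: zlb; rewrite inE eqxx.
  - exact: aux bx by' xy zm.
  - by apply/esym; apply: (aux n m' m y x) => //; rewrite metric_sym.
- move=> x.
  (* The first ball that contains [x]: all earlier depths vanish, so any [n] with [2 * c n < f x m]
     works. *)
  have [m [[fm mmin] _]] : exists! z, minimum_of lt [pred m | 0 < f x m] z.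
    by apply: woP; exists x; rewrite inE /= /f mdistxx subr0 lt_max r_gt0 orbT.
  have gm : g x m = 0.
    apply/eqP; rewrite eq_le psup_ge0 andbT; apply: psup_le => // m' [lm nm].
    rewrite leNgt; apply/negP => fm'.
    have mm' := mmin m' fm'.
    apply: nm.
    (* Antisymmetry of [lt] is read off from the uniqueness of the minimum of a pair. *)
    have [z [_ zu]] : exists! z, minimum_of lt (pred2 m m') z.
      by apply: woP; exists m; rewrite inE eqxx.
    have rr u : lt u u.
      have [v [[+ vl] _]] : exists! z, minimum_of lt (pred1 u) z.
        by apply: woP; exists u; rewrite inE.
      by rewrite inE => /eqP vu; rewrite -{1}vu; apply: vl; rewrite inE.
    have zm' : z = m'.
      apply: zu; split; first by rewrite inE eqxx orbT.
      by move=> v; rewrite inE => /orP[|] /eqP ->.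
    have zm : z = m.
      apply: zu; split; first by rewrite inE eqxx.
      by move=> v; rewrite inE => /orP[|] /eqP ->.
    by rewrite -zm' -zm.
  have fm0 : 0 < f x m by exact: fm.
  have [n nf] : exists n, 2 * c n < f x m.
    have [n _ nP] := near_infty_natSinv_lt (PosNum (divr_gt0 fm0 (ltr0n R 2))).
    exists n; have := nP n (leqnn n); rewrite /= -/(c n) ltr_pdivlMr // mulrC.
    by rewrite mulrC.
  exists n, m; rewrite /b gm lt_max; apply/orP; right; rewrite lt_min.
  by rewrite subr0 c_gt0 andbT subr_gt0.
Qed.

End stone.

(** Otherwise every point of [K] has a neighborhood whose complement lies in [F]. Compactness then
    gives one [i] in [F] such that the interior of its complement contains [K]; this interior is in
    [F] too, a contradiction. *)
Lemma compact_ultra_cvg (X : topologicalType) (K : set X) (F : set_system X) :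
  compact K -> UltraFilter F -> (forall O, open O -> K `<=` O -> F O) ->
  exists2 x, K x & F --> x.
Proof.
move=> cK FU FO; have FF : ProperFilter F by exact: ultra_proper.
apply: contrapT => nK.
have : \forall i \near powerset_filter_from F, K `<=` (fun x => nbhs x (~` i)).
  move/compact_near_coveringP: cK; apply => x Kx.
  have : ~ F --> x by move=> Fx; apply: nK; exists x.
  move=> /existsNP[B /not_implyP[nB FB]].
  have FCB : F (~` B) by have [|] := in_ultra_setVsetC B FU.
  near=> x' i => /=.
  suff : nbhs x' B.
    apply: filterS => z Bz iz.
    by have : (~` B) z by apply: (near (small_set_sub FCB) i).
  by near: x'; exact: nbhs_interior.
case=> G [GF _ [i Gi]] /(_ i Gi) Ki.
have FI : F (interior (~` i)).
  by apply: FO; [exact: open_interior|exact: Ki].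
have [z [iz /nbhs_singleton]] := filter_ex (filterI (GF _ Gi) FI).
exact.
Unshelve. all: end_near. Qed.

(** If all neighborhoods of [K] and [L] meet, their intersections generate a filter. An ultrafilter
    above it converges to a point of [K] and to a point of [L], which must coincide. *)
Lemma compact_separation (X : topologicalType) (K L : set X) :
  hausdorff_space X -> compact K -> compact L -> K `&` L = set0 ->
  exists U V, [/\ open U, open V, K `<=` U, L `<=` V & U `&` V = set0].
Proof.
move=> hX cK cL KL0; apply: contrapT => nUV.
pose D := [set UV : set X * set X |
  [/\ open UV.1, open UV.2, K `<=` UV.1 & L `<=` UV.2]].
pose G := filter_from D (fun UV => UV.1 `&` UV.2).
have FG : ProperFilter G.
  apply: filter_from_proper.
    apply: filter_from_filter.
      by exists (setT, setT); split => //; exact: openT.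
    move=> [U V] [U' V'] [oU oV KU LV] [oU' oV' KU' LV'].
    exists (U `&` U', V `&` V'); last by move=> x [[? ?] [? ?]].
    by split; try exact: openI; move=> x ?; split;
      [exact: KU|exact: KU'|exact: LV|exact: LV'].
  move=> [U V] [oU oV KU LV]; apply: contrapT => UV0; apply: nUV.
  exists U, V; split => //; apply: contrapT => UV; apply: UV0.
  by apply/set0P/eqP.
have [F [FU GF]] := ultraFilterLemma FG.
have FF : ProperFilter F by exact: ultra_proper.
have [k Kk Fk] : exists2 x, K x & F --> x.
  apply: compact_ultra_cvg => // O oO KO; apply: GF.
  by exists (O, setT); [split => //; exact: openT|move=> x []].
have [l Ll Fl] : exists2 x, L x & F --> x.
  apply: compact_ultra_cvg => // O oO KO; apply: GF.
  by exists (setT, O); [split => //; exact: openT|move=> x []].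
have kl : k = l by exact: hausdorff_cvg_unique Fk Fl.
have : (K `&` L) k by split => //; rewrite kl.
by rewrite KL0.
Qed.

Section perfect_to_metric.
Context {R : realType} {E : topologicalType} {M : metricType R} (p : E -> M).
Hypothesis pp : perfect_map p.

(** The image of the complement of [O] is closed and misses [m]. The radius is capped at 1 to meet
    the hypothesis of [sigma_discrete_bumps]. *)
Lemma near_fiber_metric (O : set E) m : open O -> p @^-1` [set m] `<=` O ->
  exists2 r, 0 < r <= 1 & forall x, mdist m (p x) < r -> O x.
Proof.
move=> oO fO; have [_ clp _] := pp.
have oC : open (~` (p @` (~` O))).
  by apply: closed_openC; apply: clp; exact: open_closedC.
have : nbhs m (~` (p @` (~` O))).
  apply: open_nbhs_nbhs; split => // -[x Ox xm].
  exact/Ox/fO.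
rewrite -nbhs_ballE => -[e /= e0]; rewrite ballEmdist => be.
exists (Num.min e 1); first by rewrite lt_min e0 ltr01 ge_min lexx orbT.
move=> x; rewrite lt_min => /andP[mx _]; apply: contrapT => nOx.
by apply: (be _ mx); exists x.
Qed.

Lemma near_metric x (e : R) : 0 < e -> \forall y \near x, mdist (p x) (p y) < e.
Proof.
move=> e0; have [cp _ _] := pp.
have := cp x (ball (p x) e) (nbhsx_ballx _ _ e0).
by rewrite ballEmdist.
Qed.

End perfect_to_metric.

Lemma normal_urysohn (R : realType) (E : topologicalType) (A B : set E) :
  normal_space E -> closed A -> closed B -> A `&` B = set0 ->
  exists f : E -> R, [/\ continuous f, forall x, 0 <= f x <= 1,
    forall x, A x -> f x = 0 & forall x, B x -> f x = 1].
Proof.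
move=> nE clA clB AB0.
have /(@uniform_separatorP _ R)[f [cf f01 f0 f1]] :=
  (@normal_separatorP R E).1 nE A B clA clB AB0.
exists f; split => //.
- by move=> x; have /f01 : range f (f x) by []; rewrite /= in_itv.
- by move=> x Ax; apply: f0; exists x.
- by move=> x Bx; apply: f1; exists x.
Qed.

Section p_paracompact_normal.
Context {R : realType} (E : topologicalType).
Hypothesis ppE : p_paracompact R E.

(** The traces of [A] and [B] on a fibre are compact, so they have disjoint neighborhoods that work
    over a whole ball of [M]. At each level [n] the bumps are discrete, so these local choices do
    not interfere; only countably many levels remain to be combined. *)
Lemma countable_separation (A B : set E) : closed A -> closed B ->
  A `&` B = set0 -> exists O P : nat -> set E,
  [/\ forall n, open (O n) /\ open (P n),
      A `<=` \bigcup_n O n, B `<=` \bigcup_n P n,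
      forall n, closure (O n) `&` B = set0
    & forall n, closure (P n) `&` A = set0].
Proof.
move=> clA clB AB0.
have /p_paracompactE[hE [M [p pp]]] := ppE.
have [cp clp kp] := pp.
have /choice[U0 U0P] : forall m, exists rUV : R * (set E * set E),
    [/\ 0 < rUV.1 <= 1, open rUV.2.1 /\ open rUV.2.2,
      forall x, mdist m (p x) < rUV.1 -> A x -> rUV.2.1 x,
      forall x, mdist m (p x) < rUV.1 -> B x -> rUV.2.2 x
    & rUV.2.1 `&` rUV.2.2 = set0].
  move=> m.
  have cA : compact (A `&` p @^-1` [set m]).
    by rewrite setIC; exact: compact_closedI (kp m) clA.
  have cB : compact (B `&` p @^-1` [set m]).
    by rewrite setIC; exact: compact_closedI (kp m) clB.
  have [|U [V [oU oV AU BV UV]]] := compact_separation hE cA cB.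
    apply/seteqP; split => // x [[Ax _] [Bx _]].
    have : (A `&` B) x by [].
    by rewrite AB0.
  have [r1 r1P r1O] : exists2 r, 0 < r <= 1 & forall x, mdist m (p x) < r ->
      (~` A `|` U) x.
    apply: near_fiber_metric => //; first by apply: openU => //; exact: closed_openC.
    by move=> x px; have [Ax|nAx] := pselect (A x); [right; exact: AU|left].
  have [r2 r2P r2O] : exists2 r, 0 < r <= 1 & forall x, mdist m (p x) < r ->
      (~` B `|` V) x.
    apply: near_fiber_metric => //; first by apply: openU => //; exact: closed_openC.
    by move=> x px; have [Bx|nBx] := pselect (B x); [right; exact: BV|left].
  exists (Num.min r1 r2, (U, V)); split => //=.
  - by case/andP: r1P => ? ?; case/andP: r2P => ? ?; rewrite lt_min ge_min;
      apply/andP; split; [apply/andP|apply/orP; left].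
  - by move=> x; rewrite lt_min => /andP[/r1O[]].
  - by move=> x; rewrite lt_min => /andP[_ /r2O[]].
have r0 m : 0 < (U0 m).1 by have [/andP[]] := U0P m.
have r1 m : (U0 m).1 <= 1 by have [/andP[]] := U0P m.
have [c [bump [[c01 _] [_ bumpL] bumpS bumpD bumpC]]] := sigma_discrete_bumps r0 r1.
pose O (W : M -> set E) n := [set x | exists2 m, 0 < bump n m (p x) & W m x].
have oO W n : (forall m, open (W m)) -> open (O W n).
  move=> oW; rewrite openE => x [m bx Wx].
  near=> y; exists m; last first.
    by near: y; apply: open_nbhs_nbhs.
  have : mdist (p x) (p y) < bump n m (p x) by near: y; exact: near_metric.
  by have := bumpL n m (p x) (p y); rewrite ler_norml => /andP[? ?] ?; lra.
have clO W W' C n : (forall m, open (W' m)) -> (forall m, W m `&` W' m = set0) ->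
    (forall m x, mdist m (p x) < (U0 m).1 -> C x -> W' m x) ->
    closure (O W n) `&` C = set0.
  move=> oW' WW' CW'; apply/seteqP; split => // b [cb Cb].
  (* Points within [c n / 2] of [b] have images less than [c n] apart and so share the same bump
     index. The margin [c n] in [bumpS] also forces [b] into [W' m]. *)
  have c0 : 0 < c n / 2 by have /andP[? _] := c01 n; rewrite divr_gt0.
  have [y0 [[m bm _] y0b]] := cb _ (near_metric pp b c0); rewrite /= in y0b.
  have bW' : W' m b.
    apply: CW' => //; have := bumpS n m _ bm.
    have := metric_triangle m (p y0) (p b).
    by rewrite [mdist (p y0) _]metric_sym => /= ? ?; lra.
  have nb : nbhs b ((fun y => mdist (p b) (p y) < c n / 2) `&` W' m).
    by apply: filterI; [exact: near_metric|exact: open_nbhs_nbhs].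
  have [y [[m' bm' Wy] [yb W'y]]] := cb _ nb; rewrite /= in yb.
  have mm' : m = m'.
    apply: bumpD bm bm' _; have := metric_triangle (p y0) (p b) (p y).
    by rewrite [mdist (p y0) (p b)]metric_sym => ?; lra.
  have : (W m `&` W' m) y by rewrite {1}mm'.
  by rewrite WW'.
exists (O (fun m => (U0 m).2.1)), (O (fun m => (U0 m).2.2)); split.
- by move=> n; split; apply: oO => m; have [_ []] := U0P m.
- move=> x Ax; have [n [m bm]] := bumpC (p x).
  exists n => //; exists m => //; have [_ _ + _ _] := U0P m; apply => //.
  by have := bumpS _ _ _ bm; move: (c01 n) => /andP[]; move=> /= ? _; lra.
- move=> x Ax; have [n [m bm]] := bumpC (p x).
  exists n => //; exists m => //; have [_ _ _ + _] := U0P m; apply => //.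
  by have := bumpS _ _ _ bm; move: (c01 n) => /andP[]; move=> /= ? _; lra.
- move=> n; apply: (clO _ (fun m => (U0 m).2.2)); last 1 first.
  + by move=> m x; have [_ _ _ + _] := U0P m; apply.
  + by move=> m; have [_ []] := U0P m.
  + by move=> m; have [_ _ _ _] := U0P m.
- move=> n; apply: (clO _ (fun m => (U0 m).2.1)); last 1 first.
  + by move=> m x; have [_ _ + _ _] := U0P m; apply.
  + by move=> m; have [_ []] := U0P m.
  + by move=> m; have [_ _ _ _] := U0P m; rewrite setIC.
Unshelve. all: end_near. Qed.

Lemma p_paracompact_normal : normal_space E.
Proof.
apply/(@normal_openP R) => A B clA clB AB0.
have [ O [P [oOP AO BP clO clP]]] := countable_separation clA clB AB0.
(* The trick by which regular Lindelof spaces are shown to be normal. The index [k = n] is included,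
   so of two levels the later one always removes the closure of the other, also when they are
   equal. *)
pose shave (O P : nat -> set E) n :=
  O n `\` \bigcup_(k in `I_n.+1) closure (P k).
have oshave O' P' n : open (O' n) -> open (shave O' P' n).
  move=> oO'; rewrite /shave setDE; apply: openI => //; apply: closed_openC.
  by apply: closed_bigcup => // k _; exact: closed_closure.
exists (\bigcup_n shave O P n), (\bigcup_n shave P O n); split.
- by apply: bigcup_open => n _; apply: oshave; case: (oOP n).
- by apply: bigcup_open => n _; apply: oshave; case: (oOP n).
- move=> x Ax; have [n _ Ox] := AO x Ax; exists n => //; split => // -[k _ Px].
  have : (closure (P k) `&` A) x by [].
  by rewrite clP.
- move=> x Bx; have [n _ Px] := BP x Bx; exists n => //; split => // -[k _ Ox].
  have : (closure (O k) `&` B) x by [].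
  by rewrite clO.
apply/seteqP; split => // x [[n _ [Ox nP]] [k _ [Px nO]]].
have [kn|nk] := leqP k n.
  by apply: nP; exists k => //; exact: subset_closure.
by apply: nO; exists n; [rewrite /= ltnS ltnW|exact: subset_closure].
Qed.

End p_paracompact_normal.

Lemma continuous_distP {R : realType} {E : topologicalType} (f : E -> R) :
  continuous f <->
  forall x (e : R), 0 < e -> \forall y \near x, `|f x - f y| <= e.
Proof.
split=> [cf x e e0|h x].
  by have /cvgrPdist_le := cf x; apply.
by apply/cvgrPdist_le => e e0; exact: h.
Qed.

(** The modulus at [x] is uniform in the index: for [A] the whole space this is continuity of [f]
    into functions on [J] with the supremum distance. *)
Definition equicont_in {R : realType} {E : topologicalType} {J : Type}
    (A : set E) (f : E -> J -> R) : Prop :=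
  forall x, A x -> forall e : R, 0 < e ->
    \forall y \near x, A y -> forall j, `|f x j - f y j| <= e.

(** Smallness near the diagonal suffices for continuity, by the triangle inequality. The bound by 1
    keeps every [psup] of such values meaningful. *)
Definition pseudometric_cont {R : realType} {E : topologicalType}
    (D : E -> E -> R) : Prop :=
  [/\ forall x y, 0 <= D x y <= 1, forall x, D x x = 0,
      forall x y, D x y = D y x, forall x y z, D x z <= D x y + D y z
    & forall x (e : R), 0 < e -> \forall y \near x, D x y <= e].

Lemma near_all_lt (T : Type) (F : set_system T) (P : nat -> T -> Prop) N :
  Filter F -> (forall n, \near F, P n F) ->
  \near F, forall n, (n < N)%N -> P n F.
Proof.
move=> FF FP; elim: N => [|N IH]; first exact: nearW.
near=> y => n; rewrite ltnS leq_eqVlt => /orP[/eqP ->|].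
  by near: y; exact: FP.
by move: n; near: y; exact: IH.
Unshelve. all: end_near. Qed.

Lemma equicont_psup {R : realType} {E : topologicalType} {I : Type}
    (f : E -> I -> R) x (e : R) : (forall x i, f x i <= 1) ->
  equicont_in setT f -> 0 < e ->
  \forall y \near x, `|psup setT (f x) - psup setT (f y)| <= e.
Proof.
move=> f1 ef e0; have := ef x Logic.I _ e0; apply: filterS => y fxy.
by apply: psup_dist => // [|i _]; [exact: ltW|exact: fxy].
Qed.

Lemma near_all_seq (T : Type) (I : eqType) (F : set_system T)
  (P : I -> T -> Prop) (s : seq I) :
  Filter F -> (forall i, \near F, P i F) ->
  \near F, forall i, i \in s -> P i F.
Proof.
move=> FF FP; elim: s => [|i s IH]; first exact: nearW.
near=> y => j; rewrite inE => /orP[/eqP ->|].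
  by near: y; exact: FP.
by move: j; near: y; exact: IH.
Unshelve. all: end_near. Qed.

Lemma compact_finite_cover (X : topologicalType) (K : set X) (O : X -> set X) :
  compact K -> (forall x, K x -> open (O x) /\ O x x) ->
  exists s : seq X, K `<=` [set y | exists2 x, x \in s & O x y].
Proof.
move=> /compact_near_coveringP cK KO.
pose F := filter_from [set: seq X] (fun s => [set t : seq X | {subset s <= t}]).
have FF : Filter F.
  apply: filter_from_filter; first by exists [::].
  move=> s t _ _; exists (s ++ t) => // u su.
  by split => x xs; apply: su; rewrite mem_cat xs ?orbT.
have [|s _ sP] := cK _ F (fun s y => exists2 x, x \in s & O x y) FF.
  move=> x /KO[oO Ox].
  exists (O x, [set s : seq X | x \in s]); first split => /=.
  - exact: open_nbhs_nbhs.
  - by exists [:: x] => // s xs; apply: xs; rewrite inE.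
  by move=> [y s] /= [Oy xs]; exists x.
by exists s; exact: sP.
Qed.

Section partition.
Context {R : realType} {E : topologicalType}.
Hypothesis ppE : p_paracompact R E.

(** Over the ball of [m], finitely many Urysohn functions [u x] cover; each is multiplied by the
    bumps of [m]. Uniformity in the index has three sources: levels with small [c n] vary little,
    near a point each of the other levels has at most one active [m], and that [m] involves finitely
    many [u x]. *)
Lemma equicont_bumps (Q : set E -> Prop) :
  (forall x, exists O, [/\ open O, O x & Q O]) ->
  exists (I : Type) (q : E -> I -> R),
  [/\ forall x i, 0 <= q x i <= 1, equicont_in setT q,
      forall i, exists2 O, Q O & forall x, 0 < q x i -> O x
    & forall x, exists i, 0 < q x i].
Proof.
move=> cov.
have /p_paracompactE[hE [M [p pp]]] := ppE.
have [cp clp kp] := pp.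
have /choice[u uP] : forall x, exists u : E -> R, [/\ continuous u,
    forall y, 0 <= u y <= 1, u x = 1
    & exists2 O, Q O & forall y, 0 < u y -> O y].
  move=> x; have [ O [oO Ox QO]] := cov x.
  have cx : closed [set x].
    exact/accessible_closed_set1/hausdorff_accessible.
  have [|f [cf f01 f0 f1]] :=
      normal_urysohn R (p_paracompact_normal ppE) (open_closedC oO) cx.
    by apply/seteqP; split => // y [nOy /= yx]; apply: nOy; rewrite yx.
  exists f; split => //; first exact: f1.
  exists O => // y fy; apply: contrapT => nOy.
  by move: fy; rewrite f0 ?ltxx.
have /choice[F FP] : forall m, exists rF : (R * seq E)%type, 0 < rF.1 <= 1 /\
    forall y, mdist m (p y) < rF.1 -> exists2 x, x \in rF.2 & 0 < u x y.
  move=> m; have oU x : open [set y | 0 < u x y].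
    have [cu _ _ _] := uP x.
    exact: (open_comp (fun y _ => cu y) (@open_gt _ 0)).
  have [|D DK] := compact_finite_cover (O := fun x => [set y | 0 < u x y]) (kp m).
    by move=> x _; split; [exact: oU|have [_ _ /= -> _] := uP x; exact: ltr01].
  have [r r0 rP] : exists2 r, 0 < r <= 1 & forall y, mdist m (p y) < r ->
      [set y | exists2 x, x \in D & 0 < u x y] y.
    apply: near_fiber_metric => //; rewrite openE => y /= [x xD uy].
    have := open_nbhs_nbhs (conj (oU x) uy).
    by apply: filterS => z; exists x.
  by exists (r, D).
have r0 m : 0 < (F m).1 by have [/andP[]] := FP m.
have r1 m : (F m).1 <= 1 by have [/andP[]] := FP m.
have [c [bump [[c01 cN] [bump01 bumpL] bumpS bumpD bumpC]]] := sigma_discrete_bumps r0 r1.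
have bump_le1 n m x : bump n m x <= 1.
  have /andP[_ /le_trans] := bump01 n m x; apply.
  by case/andP: (c01 n).
pose q y (i : nat * M * E) : R :=
  if i.2 \in (F i.1.2).2 then bump i.1.1 i.1.2 (p y) * u i.2 y else 0.
have u01 x y : 0 <= u x y <= 1 by have [] := uP x.
have q_ge0 y i : 0 <= q y i.
  rewrite /q; case: ifP => // _; have /andP[b0 _] := bump01 i.1.1 i.1.2 (p y).
  by rewrite mulr_ge0 //; case/andP: (u01 i.2 y).
have q_le y i : q y i <= c i.1.1.
  rewrite /q; case: ifP => [_|_]; last first.
    by case/andP: (c01 i.1.1) => /ltW.
  have /andP[b0 b1] := bump01 i.1.1 i.1.2 (p y); apply: le_trans b1.
  by rewrite ler_piMr //; case/andP: (u01 i.2 y).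
have q_bump y i : bump i.1.1 i.1.2 (p y) = 0 -> q y i = 0.
  by rewrite /q => ->; rewrite mul0r if_same.
have qc i x (e : R) : 0 < e -> \forall y \near x, `|q x i - q y i| <= e.
  move: x e; apply/(continuous_distP (q^~ i)).
  case iF : (i.2 \in (F i.1.2).2); last first.
    have -> : q^~ i = cst 0 by apply/funext => y; rewrite /q iF.
    by move=> z; exact: cvg_cst.
  have -> : q^~ i = (fun y => bump i.1.1 i.1.2 (p y) * u i.2 y).
    by apply/funext => y; rewrite /q iF.
  move=> z; apply: cvgM; last by have [cu _ _ _] := uP i.2; exact: cu.
  move: z; apply/continuous_distP => z d d0.
  near=> y; apply: le_trans (bumpL _ _ _ _) _; apply: ltW.
  by near: y; exact: near_metric.
exists (nat * M * E)%type, q; split.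
- move=> x i; rewrite q_ge0 /=; apply: le_trans (q_le x i) _.
  by case/andP: (c01 i.1.1).
- move=> x _ e e0.
  have [N NP] := cN e e0.
  have near_n n : \forall y \near x, forall m x0,
      `|q x (n, m, x0) - q y (n, m, x0)| <= e.
    have c0 : 0 < c n / 2 by have /andP[? _] := c01 n; rewrite divr_gt0.
    have nx := near_metric pp x c0.
    have [[m0 [y0 [xy0 bm0]]]|nob] := pselect (exists m0 y0,
        mdist (p x) (p y0) < c n / 2 /\ 0 < bump n m0 (p y0)); last first.
      apply: filterS nx => y xy m x0.
      have bz z : mdist (p x) (p z) < c n / 2 -> bump n m (p z) = 0.
        move=> xz; apply/eqP; rewrite eq_le; have /andP[-> _] := bump01 n m (p z).
        rewrite andbT leNgt; apply/negP => bz; apply: nob.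
        by exists m, z.
      by rewrite !q_bump ?subrr ?normr0 ?(ltW e0) ?bz //= mdistxx.
    have nF : \forall y \near x, forall x0, x0 \in (F m0).2 ->
        `|q x (n, m0, x0) - q y (n, m0, x0)| <= e.
      by apply: near_all_seq => x0; exact: qc.
    near=> y => m x0.
    have xy : mdist (p x) (p y) < c n / 2 by near: y.
    have [mm0|mm0] := pselect (m = m0).
      have [x0F|x0F] := boolP (x0 \in (F m0).2).
        by rewrite mm0; move: x0 x0F; near: y.
      by rewrite /q /= mm0 (negbTE x0F) subrr normr0 ltW.
    have bz z : mdist (p x) (p z) < c n / 2 -> bump n m (p z) = 0.
      move=> xz; apply/eqP; rewrite eq_le; have /andP[-> _] := bump01 n m (p z).
      rewrite andbT leNgt; apply/negP => bz; apply: mm0.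
      apply: bumpD bz bm0 _; have := metric_triangle (p z) (p x) (p y0).
      by rewrite [mdist (p z) (p x)]metric_sym => ?; lra.
    by rewrite !q_bump ?subrr ?normr0 ?(ltW e0) ?bz //= mdistxx.
  near=> y => _ [[n m] x0].
  have [nN|Nn] := ltnP n N.
    suff : forall n, (n < N)%N -> forall m x0,
      `|q x (n, m, x0) - q y (n, m, x0)| <= e by apply.
    by near: y; exact: near_all_lt.
  have := q_le x (n, m, x0); have := q_le y (n, m, x0).
  have := q_ge0 x (n, m, x0); have := q_ge0 y (n, m, x0).
  have := NP _ Nn; rewrite /= ler_norml => ? ? ? ? ?; apply/andP; split; lra.
- move=> [[n m] x0]; have [_ _ _ [ O QO OP]] := uP x0; exists O => // x.
  rewrite /q /=; case: ifP => [_|_]; last by rewrite ltxx.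
  move=> bu; apply: OP; rewrite lt_neqAle; case/andP: (u01 x0 x) => -> _.
  by rewrite andbT eq_sym; apply: contraTneq bu => ->; rewrite mulr0 ltxx.
- move=> x; have [n [m bm]] := bumpC (p x).
  have [_ /(_ x)[]] := FP m.
    have := bumpS _ _ _ bm; have /andP[] := c01 n.
    by move=> /= ? _ ?; lra.
  move=> x0 x0F ux0; exists (n, m, x0).
  by rewrite /q /= x0F mulr_gt0.
Unshelve. all: end_near. Qed.

(** The bumps are divided by their supremum instead of their sum, so local finiteness is not an
    issue, and everywhere some member exceeds one half. *)
Lemma equicont_partition (Q : set E -> Prop) :
  (forall x, exists O, [/\ open O, O x & Q O]) ->
  exists (I : Type) (t : E -> I -> R),
  [/\ forall x i, 0 <= t x i <= 1, equicont_in setT t,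
      forall i, exists2 O, Q O & forall x, 0 < t x i -> O x
    & forall x, exists i, 1 / 2 < t x i].
Proof.
move=> /equicont_bumps[I [q [q01 eq qQ q_gt0]]].
have q_ge0 x i : 0 <= q x i by case/andP: (q01 x i).
have q_le1 x i : q x i <= 1 by case/andP: (q01 x i).
pose s x := psup setT (q x).
have q_les x i : q x i <= s x by apply: psup_ub.
have s_gt0 x : 0 < s x by have [i qi] := q_gt0 x; exact: lt_le_trans (q_les x i).
exists I, (fun x i => q x i / s x); split.
- move=> x i; rewrite divr_ge0 ?q_ge0 ?(ltW (s_gt0 x)) //=.
  by rewrite ler_pdivrMr // mul1r.
- move=> x _ e e0.
  (* Over the denominator [s x * s y] the difference of quotients has two terms, each at most this
     constant times [s y], because [q y i <= s y]. *)
  have d0 : 0 < e * s x / 2 by rewrite divr_gt0 // mulr_gt0.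
  near=> y => _ i.
  have qxy : `|q x i - q y i| <= e * s x / 2.
    by move: i; near: y; have := eq x Logic.I _ d0; apply: filterS => y; exact.
  have sxy : `|s x - s y| <= e * s x / 2.
    by near: y; exact: equicont_psup.
  have -> : q x i / s x - q y i / s y =
      ((q x i - q y i) * s y + q y i * (s y - s x)) / (s x * s y).
    by field; rewrite !gt_eqF.
  rewrite normrM normfV [`|s x * s y|]gtr0_norm ?mulr_gt0 //.
  rewrite ler_pdivrMr ?mulr_gt0 //; apply: le_trans (ler_normD _ _) _.
  rewrite !normrM [`|s y|]gtr0_norm // [`|q y i|]ger0_norm // [`|s y - _|]distrC.
  have -> : e * (s x * s y) = e * s x / 2 * s y + s y * (e * s x / 2) by field.
  apply: lerD; first by rewrite ler_wpM2r // ltW.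
  by rewrite ler_pM.
- move=> i; have [ O QO OP] := qQ i; exists O => // x; rewrite pmulr_lgt0 ?invr_gt0 //.
  exact: OP.
- move=> x; have [i _ qi] : exists2 i, setT i & s x / 2 < q x i.
    apply: psup_gt; first by rewrite divr_ge0 // ltW.
    by rewrite -/(s x); have := s_gt0 x; lra.
  by exists i; rewrite ltr_pdivlMr // mulrC mulrA mulr1.
Unshelve. all: end_near. Qed.

End partition.

(** * Extension of equicontinuous families *)

Section pseudometrics.
Context {R : realType} {E : topologicalType}.

Lemma pseudometric_cont_psup (I : Type) (f : E -> I -> R) :
  (forall x i, 0 <= f x i <= 1) -> equicont_in setT f ->
  pseudometric_cont
    (fun x y => Num.min 1 (4 * psup setT (fun i => `|f x i - f y i|))).
Proof.
move=> f01 ef; pose S x y := psup setT (fun i => `|f x i - f y i|).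
have S1 x y i : `|f x i - f y i| <= 1.
  have /andP[? ?] := f01 x i; have /andP[? ?] := f01 y i.
  by rewrite ler_norml; apply/andP; split; lra.
have S0 x y : 0 <= S x y by exact: psup_ge0.
split => [x y|x|x y|x y z|x e e0]; rewrite -?/(S _ _).
- by rewrite le_min ler01 ge_min lexx /= mulr_ge0.
- have -> : S x x = 0.
    apply/eqP; rewrite eq_le S0 andbT; apply: psup_le => // i _.
    by rewrite subrr normr0.
  by rewrite mulr0; apply/min_idPr.
- by congr (Num.min _ (_ * psup _ _)); apply/funext => i; rewrite distrC.
- have tr : S x z <= S x y + S y z.
    apply: psup_le; first by rewrite addr_ge0.
    move=> i _; have -> : f x i - f z i = (f x i - f y i) + (f y i - f z i).
      by ring.
    apply: le_trans (ler_normD _ _) _; apply: lerD.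
      by apply: (psup_ub (f := fun i => `|f x i - f y i|)).
    by apply: (psup_ub (f := fun i => `|f y i - f z i|)).
  have := S0 x y; have := S0 y z.
  rewrite /Num.min; do 3! case: ifP => ?; lra.
- have e4 : 0 < e / 4 by rewrite divr_gt0.
  have := ef x Logic.I _ e4; apply: filterS => y xy.
  have : S x y <= e / 4.
    by apply: psup_le; [exact: ltW|move=> i _; exact: xy].
  by rewrite ge_min => ?; apply/orP; right; rewrite -/(S _ _); lra.
Qed.

Lemma pseudometric_cont_max (D D' : E -> E -> R) : pseudometric_cont D ->
  pseudometric_cont D' ->
  pseudometric_cont (fun x y => Num.max (D x y) (D' x y)).
Proof.
move=> [D01 Dxx Ds Dt Dc] [D01' Dxx' Ds' Dt' Dc']; split.
- move=> x y; have /andP[? ?] := D01 x y; have /andP[? ?] := D01' x y.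
  by rewrite le_max ge_max; apply/andP; split; [apply/orP; left|apply/andP].
- by move=> x; rewrite Dxx Dxx' maxxx.
- by move=> x y; rewrite Ds Ds'.
- move=> x y z; have := Dt x y z; have := Dt' x y z.
  by rewrite /Num.max; do 3! case: ifP => ?; lra.
- move=> x e e0; near=> y; rewrite ge_max; apply/andP; split; near: y.
    exact: Dc.
  exact: Dc'.
Unshelve. all: end_near. Qed.

Lemma pseudometric_cont_metric (M : metricType R) (p : E -> M) :
  continuous p -> pseudometric_cont (fun x y => Num.min 1 (mdist (p x) (p y))).
Proof.
move=> cp; split.
- by move=> x y; rewrite le_min ler01 mdist_ge0 ge_min lexx.
- by move=> x; rewrite mdistxx; apply/min_idPr.
- by move=> x y; rewrite metric_sym.
- move=> x y z; have := metric_triangle (p x) (p y) (p z).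
  have := mdist_ge0 (p x) (p y); have := mdist_ge0 (p y) (p z).
  by rewrite /Num.min; do 3! case: ifP => ?; lra.
- move=> x e e0; have := cp x (ball (p x) e) (nbhsx_ballx _ _ e0).
  rewrite ballEmdist => h; near=> y; rewrite ge_min; apply/orP; right.
  by apply: ltW; near: y.
Unshelve. all: end_near. Qed.

(* [D] compares the members of partitions on whose supports [f] oscillates by at
   most [1 / n.+1] on [A].  If [n] is least with [1 / n.+1 < |f a j - f b j|],
   no such support contains both [a] and [b], so the [n]th partition sees a
   difference above [1 / 2], while [|f a j - f b j| <= 1 / n <= 2 / n.+1]; this
   is where the factor [4] comes from. *)
Lemma pseudometric_domination (J : Type) (A : set E) (f : E -> J -> R) :
  p_paracompact R E -> closed A -> (forall x j, A x -> 0 <= f x j <= 1) ->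
  equicont_in A f ->
  exists2 D : E -> E -> R, pseudometric_cont D &
    forall a b j, A a -> A b -> `|f a j - f b j| <= D a b.
Proof.
move=> ppE clA f01 ef.
pose c n : R := n.+1%:R^-1.
have c0 n : 0 < c n by rewrite invr_gt0.
have c1 n : c n <= 1 by rewrite /c invf_le1 ?ler1n ?ltr0n.
pose Q n (O : set E) :=
  forall a b j, A a -> A b -> O a -> O b -> `|f a j - f b j| <= c n.
have /choice[t tP] : forall n, exists t : {I : Type & E -> I -> R},
  [/\ forall x i, 0 <= projT2 t x i <= 1, equicont_in setT (projT2 t),
      forall i, exists2 O, Q n O & forall x, 0 < projT2 t x i -> O x
    & forall x, exists i, 1 / 2 < projT2 t x i].
  move=> n; have [|I [t tP]] := equicont_partition (Q := Q n) ppE.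
    move=> x; have [Ax|nAx] := pselect (A x); last first.
      by exists (~` A); split => //; exact: closed_openC.
    have c2 : 0 < c n / 2 by rewrite divr_gt0.
    have : nbhs x [set y | A y -> forall j, `|f x j - f y j| <= c n / 2].
      exact: (ef x Ax _ c2).
    rewrite nbhsE => -[ O [oO Ox] OP].
    exists O; split => // a b j Aa Ab Oa Ob.
    have := OP a Oa Aa j; have := OP b Ob Ab j.
    rewrite !ler_norml => /andP[? ?] /andP[? ?].
    by apply/andP; split; lra.
  by exists (existT _ I t).
pose I := {n : nat & projT1 (t n)}.
(* The weight [c n] makes all but finitely many levels uniformly small, so that the partitions for
   all [n] form one equicontinuous family. *)
pose g x (i : I) : R := c (projT1 i) * projT2 (t (projT1 i)) x (projT2 i).
have t01 n x i : 0 <= projT2 (t n) x i <= 1 by have [] := tP n.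
have g01 x i : 0 <= g x i <= c (projT1 i).
  have /andP[? ?] := t01 (projT1 i) x (projT2 i).
  by rewrite mulr_ge0 ?ler_piMr // ltW.
have g01' x i : 0 <= g x i <= 1.
  by have /andP[-> /= h] := g01 x i; exact: le_trans h (c1 _).
have eg : equicont_in setT g.
  move=> x _ e e0.
  have [N _ NP] := near_infty_natSinv_lt (PosNum e0).
  near=> y => _ [n i]; rewrite /g /=.
  have [nN|Nn] := ltnP n N; last first.
    have := NP _ Nn; rewrite /= -/(c n) => cn.
    have := g01 x (existT _ n i); have := g01 y (existT _ n i).
    rewrite /g /= => /andP[? ?] /andP[? ?].
    by rewrite ler_norml; apply/andP; split; lra.
  suff : forall n, (n < N)%N -> forall i,
      `|projT2 (t n) x i - projT2 (t n) y i| <= e.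
    move=> /(_ n nN i) h; rewrite -mulrBr normrM gtr0_norm //.
    by apply: le_trans h; rewrite ler_piMl.
  near: y; apply: near_all_lt => m; have [_ et _ _] := tP m.
  by have := et x Logic.I e e0; apply: filterS => y; exact.
exists (fun x y => Num.min 1 (4 * psup setT (fun i => `|g x i - g y i|))).
  exact: pseudometric_cont_psup.
move=> a b j Aa Ab; set v := `|_ - _|.
have v1 : v <= 1.
  have /andP[? ?] := f01 a j Aa; have /andP[? ?] := f01 b j Ab.
  by rewrite /v ler_norml; apply/andP; split; lra.
rewrite le_min v1 /= leNgt; apply/negP => Sv.
have Sab := psup_ge0 setT (fun i => `|g a i - g b i|).
have v0 : 0 < v by apply: le_lt_trans Sv; rewrite mulr_ge0.
have exn : exists n, c n < v.
  by have [N _ NP] := near_infty_natSinv_lt (PosNum v0); exists N; exact: NP N (leqnn N).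
case: (ex_minnP exn) => n cn nmin.
have vc : v <= 2 * c n.
  case: n cn nmin => [|n] cn nmin.
    by move: cn; rewrite /c invr1; lra.
  have vn : v <= c n by rewrite leNgt; apply/negP => /nmin; rewrite ltnn.
  apply: le_trans vn _; rewrite /c -ler_pdivrMl // mulrC.
  rewrite -invfM lef_pV2 ?posrE ?mulr_gt0 // -natrM ler_nat.
  by rewrite muln2 doubleS -addnn !ltnS leq_addr.
have [_ _ tQ tC] := tP n.
have [i ia] := tC a.
have [ O QO OP] := tQ i.
have ib : projT2 (t n) b i <= 0.
  rewrite leNgt; apply/negP => ib.
  have : v <= c n by apply: QO => //; apply: OP => //; apply: lt_trans ia; lra.
  by rewrite leNgt cn.
have S1 i0 : `|g a i0 - g b i0| <= 1.
  have /andP[? ?] := g01' a i0; have /andP[? ?] := g01' b i0.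
  by rewrite ler_norml; apply/andP; split; lra.
have : `|g a (existT _ n i) - g b (existT _ n i)| <=
    psup setT (fun i => `|g a i - g b i|).
  by apply: (psup_ub (f := fun i => `|g a i - g b i|)).
rewrite /g /= -mulrBr normrM gtr0_norm //.
have h : c n * (1 / 2) <= c n * `|projT2 (t n) a i - projT2 (t n) b i|.
  rewrite ler_pM2l //; apply: le_trans (ler_norm _); lra.
move=> h'; lra.
Unshelve. all: end_near. Qed.

End pseudometrics.

(** Compactness of [K] makes the neighborhood of [x] independent of [k]. With [K] a group and [a]
    its action, this turns a pseudometric into an invariant one. *)
Lemma pseudometric_cont_psup_compact (R : realType) (K X Y : topologicalType)
    (a : K * X -> Y) (D : Y -> Y -> R) :
  compact [set: K] -> continuous a -> pseudometric_cont D ->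
  pseudometric_cont (fun x y => psup setT (fun k => D (a (k, x)) (a (k, y)))).
Proof.
move=> cK ca [D01 Dxx Ds Dt Dc].
have D1 x y : D x y <= 1 by case/andP: (D01 x y).
have D0 x y : 0 <= D x y by case/andP: (D01 x y).
split.
- by move=> x y; rewrite psup_ge0 psup_le.
- move=> x; apply/eqP; rewrite eq_le psup_ge0 andbT; apply: psup_le => // k _.
  by rewrite Dxx.
- by move=> x y; congr psup; apply/funext => k; rewrite Ds.
- move=> x y z; apply: psup_le; first by rewrite addr_ge0 ?psup_ge0.
  move=> k _; apply: le_trans (Dt _ (a (k, y)) _) _; apply: lerD.
    by apply: (psup_ub (f := fun k => D (a (k, x)) (a (k, y)))).
  by apply: (psup_ub (f := fun k => D (a (k, y)) (a (k, z)))).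
- move=> x e e0; have e2 : 0 < e / 2 by rewrite divr_gt0.
  have : \forall y \near x, [set: K] `<=` (fun k => D (a (k, x)) (a (k, y)) <= e).
    move/compact_near_coveringP: cK; apply => k _.
    have [[U V] [/= kU xV] UV] := ca (k, x) _ (Dc (a (k, x)) _ e2).
    exists (U, V) => // -[k' y] [/= Uk' Vy].
    have := UV (k', y) (conj Uk' Vy); have := UV (k', x) (conj Uk' (nbhs_singleton xV)).
    rewrite /= => h1 h2; have := Dt (a (k', x)) (a (k, x)) (a (k', y)).
    by rewrite [D (a (k', x)) (a (k, x))]Ds; lra.
  by apply: filterS => y h; apply: psup_le => [|k _]; [exact: ltW|exact: h].
Qed.

Record continuous_hom (H G : topologicalGroupType) := ContinuousHom {
  hom_fun :> H -> G;
  hom_continuous : continuous hom_fun;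
  homM : forall h k, hom_fun (h * k)%g = (hom_fun h * hom_fun k)%g
}.

Lemma hom1 (H G : topologicalGroupType) (i : continuous_hom H G) :
  i 1%g = 1%g.
Proof. by apply: (mulgI (i 1%g)); rewrite -homM !mulg1. Qed.

Section equivariant_extension.
Context {R : realType} {H G : topologicalGroupType} (i : continuous_hom H G).
Hypotheses (cH : compact [set: H]) (cG : compact [set: G]).
Hypothesis hG : hausdorff_space G.
Context (E : gspace H) (A : set E) (J : Type) (f : E -> G -> J -> R).
Hypotheses (ppE : p_paracompact R E) (clA : closed A).
Hypothesis Ainv : forall h x, A x -> A (gact h x).
Hypothesis f01 : forall x g j, A x -> 0 <= f x g j <= 1.
Hypothesis f_cont : equicont_in (A `*` setT) (fun u : E * G => f u.1 u.2).
Hypothesis f_inv : forall h x g j, A x -> f (gact h x) g j = f x (g * i h)%g j.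

Let hact (hu : H * (E * G)) : E * G :=
  (gact hu.1 hu.2.1, (hu.2.2 * (i hu.1)^-1)%g).

Let hact_cont : continuous hact.
Proof.
apply: continuous_pair.
  apply: (continuous_compose (f := fun u : H * (E * G) => (u.1, u.2.1))
    (g := fun hx : H * E => gact hx.1 hx.2)).
    apply: continuous_pair; first exact: fst_continuous.
    exact: (continuous_compose (@snd_continuous _ _) (@fst_continuous _ _)).
  exact: gact_continuous.
apply: (continuous_compose (f := fun u : H * (E * G) => (u.2.2, (i u.1)^-1%g))
  (g := fun gh : G * G => (gh.1 * gh.2)%g)).
  apply: continuous_pair.
    exact: (continuous_compose (@snd_continuous _ _) (@snd_continuous _ _)).
  apply: (continuous_compose (f := fun u : H * (E * G) => i u.1)
    (g := fun g : G => (g^-1)%g)).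
    exact: (continuous_compose (@fst_continuous _ _) (@hom_continuous _ _ i)).
  exact: invg_continuous.
exact: mulg_continuous.
Qed.

Let hact1 u : hact (1%g, u) = u.
Proof. by case: u => x g; rewrite /hact /= gact1 hom1 invg1 mulg1. Qed.

Let hactM h k u : hact ((h * k)%g, u) = hact (h, hact (k, u)).
Proof. by case: u => x g; rewrite /hact /= gactM homM invgM mulgA. Qed.

Let hactK h u : hact (h^-1%g, hact (h, u)) = u.
Proof. by rewrite -hactM mulVg hact1. Qed.

Let hactVK h u : hact (h, hact (h^-1%g, u)) = u.
Proof. by rewrite -hactM mulgV hact1. Qed.

Let f_hact h x g j : A x -> f (hact (h, (x, g))).1 (hact (h, (x, g))).2 j = f x g j.
Proof. by move=> Ax; rewrite /= f_inv // mulgVK. Qed.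

(* [D] dominates the pullback of a metric along a perfect map; hence the infimum
   of [D x] over [A], if zero, is attained.  This makes up for the lack of
   completeness of the metrizable part of the extensors. *)
Lemma equivariant_extension : exists (F : E -> G -> J -> R) (D : E -> E -> R),
  [/\ pseudometric_cont D /\ (forall h x y, D (gact h x) (gact h y) = D x y),
      forall x, (forall e, 0 < e -> exists2 a, A a & D x a <= e) ->
        exists2 a, A a & D x a = 0,
      (forall x g j, A x -> F x g j = f x g j) /\
        (forall x g j, 0 <= F x g j <= 1),
      forall h x g j, F (gact h x) g j = F x (g * i h)%g j
    & (forall x y g j, `|F x g j - F y g j| <= D x y) /\
      (forall x, equicont_in setT (F x))].
Proof.
have ppEG : p_paracompact R (E * G)%type by exact: p_paracompact_prod_compact.
have clAG : closed (A `*` [set: G]).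
  have -> : A `*` [set: G] = @fst E G @^-1` A.
    by apply/seteqP; split => u //= [].
  by apply: preimage_closedT => //; exact: fst_continuous.
have [|D0 D0P D0f] := pseudometric_domination ppEG clAG _ f_cont.
  by move=> x j [Ax _]; exact: f01.
have /p_paracompactE[hE [M [p pp]]] := ppE.
have [cp _ _] := pp.
(* [D0] controls [f]; the second term controls [p], which is what the attainment clause rests on. *)
pose D1 u v := Num.max (D0 u v) (Num.min 1 (mdist (p u.1) (p v.1))).
have D1P : pseudometric_cont D1.
  apply: pseudometric_cont_max => //.
  apply: (pseudometric_cont_metric (p := fun u : E * G => p u.1)).
  exact: (continuous_compose (@fst_continuous _ _) cp).
(* The supremum over [H] makes the pseudometric invariant under [hact]. *)
pose D2 u v := psup setT (fun h => D1 (hact (h, u)) (hact (h, v))).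
have D2P : pseudometric_cont D2 by exact: pseudometric_cont_psup_compact.
(* The supremum over [G] leaves a pseudometric on [E]. It is [H]-invariant because, by [hactE],
   moving [x] and [y] by [h] only shifts the variable [g]. *)
pose D x y := psup setT (fun g => D2 (x, g) (y, g)).
have DP : pseudometric_cont D.
  apply: (pseudometric_cont_psup_compact (a := fun gx : G * E => (gx.2, gx.1))) => //.
  by apply: continuous_pair; [exact: snd_continuous|exact: fst_continuous].
have [D101 _ _ _ _] := D1P.
have D1le1 u v : D1 u v <= 1 by case/andP: (D101 u v).
have [D201 D2xx D2s D2t D2c] := D2P.
have D2le1 u v : D2 u v <= 1 by case/andP: (D201 u v).
have D2ge0 u v : 0 <= D2 u v by case/andP: (D201 u v).
have D12 u v : D1 u v <= D2 u v.
  rewrite -{1}(hact1 u) -{1}(hact1 v).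
  by apply: (psup_ub (f := fun h => D1 (hact (h, u)) (hact (h, v)))).
have D2D x y g : D2 (x, g) (y, g) <= D x y.
  by apply: (psup_ub (f := fun g => D2 (x, g) (y, g))).
have D2le h u v : D2 (hact (h, u)) (hact (h, v)) <= D2 u v.
  apply: psup_le => // k _; rewrite -!hactM.
  by apply: (psup_ub (f := fun h => D1 (hact (h, u)) (hact (h, v)))).
have D2inv h u v : D2 (hact (h, u)) (hact (h, v)) = D2 u v.
  apply/eqP; rewrite eq_le D2le /=.
  by have := D2le (h^-1)%g (hact (h, u)) (hact (h, v)); rewrite !hactK.
have hactE h x g : (gact h x, g) = hact (h, (x, (g * i h)%g)).
  by rewrite /hact /= mulgK.
have Dle h x y : D (gact h x) (gact h y) <= D x y.
  apply: psup_le; first exact: psup_ge0.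
  by move=> g _; rewrite !hactE D2inv.
have Dinv h x y : D (gact h x) (gact h y) = D x y.
  apply/eqP; rewrite eq_le Dle /=.
  by have := Dle (h^-1)%g (gact h x) (gact h y); rewrite -!gactM mulVg !gact1.
(* The sup-convolution is 1-Lipschitz for [D2] and equals [f] over [A] since [D2] dominates [f]
   there. Negative values are cut off by the 0 adjoined in [psup]. *)
pose F' (v : E * G) j := psup (A `*` setT) (fun u => f u.1 u.2 j - D2 v u).
have fle1 v (u : E * G) j : (A `*` [set: G]) u -> f u.1 u.2 j - D2 v u <= 1.
  move=> [Au _]; have /andP[_ h1] := f01 u.2 j Au; have := D2ge0 v u; lra.
have F'lip u v j : `|F' u j - F' v j| <= D2 u v.
  apply: psup_dist => // [w Aw|w Aw|w _]; [exact: fle1|exact: fle1|].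
  have -> : f w.1 w.2 j - D2 u w - (f w.1 w.2 j - D2 v w) = D2 v w - D2 u w.
    by ring.
  have := D2t u v w; have := D2t v u w; rewrite (D2s v u) ler_norml => ? ?.
  by apply/andP; split; lra.
have F'le h v j : F' (hact (h, v)) j <= F' v j.
  apply: psup_le; first exact: psup_ge0.
  move=> u [Au _]; have Aw : A (hact (h^-1%g, u)).1 by exact: Ainv.
  have -> : f u.1 u.2 j - D2 (hact (h, v)) u =
      f (hact (h^-1%g, u)).1 (hact (h^-1%g, u)).2 j - D2 v (hact (h^-1%g, u)).
    rewrite -{3}(hactVK h u) D2inv; congr (_ - _).
    by case: u Au {Aw} => x g /= Ax; rewrite (f_hact h^-1%g).
  by apply: (psup_ub (f := fun u => f u.1 u.2 j - D2 v u)) => // u' Au'; exact: fle1.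
exists (fun x g => F' (x, g)), D; split.
- by [].
- move=> x xA.
  (* Points of [A] that are [D]-close to [x] have images tending to [p x]. By perfectness an
     ultrafilter of such points converges, its limit lies in the closed set [A], and the triangle
     inequality puts it at distance 0. *)
  pose B := filter_from [set e : R | 0 < e] (fun e => [set a | A a /\ D x a <= e]).
  have FB : ProperFilter B.
    apply: filter_from_proper; last by move=> e /xA[a Aa xa]; exists a.
    apply: filter_from_filter; first by exists 1 => /=.
    move=> e e' /= e0 e0'; exists (Num.min e e'); first by rewrite /= lt_min e0.
    by move=> a [Aa]; rewrite le_min => /andP[? ?].
  have [U [UU BU]] := ultraFilterLemma FB.
  have FU : ProperFilter U by exact: ultra_proper.
  have UD e : 0 < e -> U [set a | A a /\ D x a <= e] by move=> e0; apply: BU; exists e.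
  have Up : p @ U --> p x.
    move=> V; rewrite -nbhs_ballE => -[e /= e0 eV].
    (* Only the distance truncated at 1 is controlled, so the threshold has to stay below 1. *)
    have e1 : 0 < Num.min e 1 / 2 by rewrite divr_gt0 // lt_min e0 ltr01.
    change (U (p @^-1` V)).
    apply: filterS (UD _ e1) => a [_ xa]; apply: eV.
    rewrite ballEmdist /=; move: xa.
    have : Num.min 1 (mdist (p x) (p a)) <= D x a.
      apply: le_trans (D2D x a 1%g); apply: le_trans (D12 _ _).
      by rewrite /D1 /= le_max lexx orbT.
    case: (leP 1 (mdist (p x) (p a))) => h; case: (leP e 1) => h'; lra.
  have [a _ Ua] := perfect_map_ultra pp UU Up.
  have [_ _ _ Dt Dc] := DP; have [D01 _ Ds _ _] := DP.
  exists a.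
    apply: clA => V nV; have UV : U V := Ua _ nV.
    by have [b [[Ab _] Vb]] := filter_ex (filterI (UD _ ltr01) UV); exists b.
  apply/eqP; rewrite eq_le; case/andP: (D01 x a) => -> _; rewrite andbT.
  apply/ler_addgt0Pl => e e0; rewrite addr0.
  have e2 : 0 < e / 2 by rewrite divr_gt0.
  have UV : U [set y | D a y <= e / 2] := Ua _ (Dc a _ e2).
  have [b [[_ xb] /= ab]] := filter_ex (filterI (UD _ e2) UV).
  by have := Dt x b a; rewrite (Ds b a); lra.
- split=> [x g j Ax|x g j]; last first.
    rewrite psup_ge0 psup_le // => u Au; exact: fle1.
  have /andP[f0 _] := f01 g j Ax.
  apply/eqP; rewrite eq_le; apply/andP; split.
    apply: psup_le => // -[y k] [/= Ay _].
    have := D0f (y, k) (x, g) j (conj Ay Logic.I) (conj Ax Logic.I).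
    have := D12 (x, g) (y, k).
    have : D0 (x, g) (y, k) <= D1 (x, g) (y, k) by rewrite le_max lexx.
    have [_ _ D0s _ _] := D0P; rewrite (D0s (y, k)) ler_norml /= => ? ? /andP[? ?].
    by lra.
  have := psup_ub (f := fun u => f u.1 u.2 j - D2 (x, g) u) (fle1 (x, g) ^~ j)
    (conj Ax Logic.I : (A `*` [set: G]) (x, g)).
  by rewrite /= D2xx subr0.
- move=> h x g j; rewrite hactE; apply/eqP; rewrite eq_le F'le /=.
  by have := F'le (h^-1)%g (hact (h, (x, (g * i h)%g))) j; rewrite hactK.
- split=> [x y g j|x g _ e e0]; first exact: le_trans (F'lip _ _ _) (D2D _ _ _).
  have cx : continuous (fun g : G => (x, g)).
    by apply: continuous_pair => z; [exact: cvg_cst|exact: cvg_id].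
  have gP : \forall k \near g, D2 (x, g) (x, k) <= e := cx g _ (D2c (x, g) e e0).
  by apply: filterS gP => k /= gk _ j; exact: le_trans (F'lip _ _ _) gk.
Qed.

End equivariant_extension.

(** * Equivariant absolute extensors *)

Lemma within_continuous_near (X Y : topologicalType) (A : set X) (f : X -> Y)
    x (B : set Y) : {within A, continuous f} -> A x -> nbhs (f x) B ->
  \forall y \near x, A y -> B (f y).
Proof.
by move=> /subspace_continuousP cf Ax nB; exact: cf x Ax B nB.
Qed.

(** [f] is a total function, constrained on [A] alone, which avoids a space structure on [A]. *)
Definition equivariant_AE (R : realType) (G : topologicalGroupType)
    (Z : gspace G) : Prop :=
  forall (H : topologicalGroupType) (i : continuous_hom H G) (E : gspace H)
    (A : set E) (f : E -> Z),
  compact [set: H] -> p_paracompact R E -> closed A ->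
  (forall h x, A x -> A (gact h x)) -> {within A, continuous f} ->
  (forall h x, A x -> f (gact h x) = gact (i h) (f x)) ->
  exists F : E -> Z, [/\ continuous F,
    forall h x, F (gact h x) = gact (i h) (F x)
    & forall x, A x -> F x = f x].

(** * The metrizable extensor: functions on G with the supremum metric *)

Section hull.
Context {R : realType} {G : topologicalGroupType} {J : Type}.
Hypothesis cG : compact [set: G].

Definition right_translate (h : G) (u : G -> J -> R) : G -> J -> R :=
  fun g => u (g * h)%g.

(* The part [N] need not be closed among all functions: it is closed in the
   hull because the other elements are bounded away from [0]. *)
Definition in_hull (N : set (G -> J -> R)) (u : G -> J -> R) : Prop :=
  [/\ forall g j, 0 <= u g j <= 1, equicont_in setT u
    & N u \/ exists2 c, 0 < c & forall g j, c <= u g j].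

Record hull (N : set (G -> J -> R)) := Hull {
  hull_fun :> G -> J -> R;
  hullP : in_hull N hull_fun
}.

Context (N : set (G -> J -> R)).
Hypothesis Ninv : forall h u, N u -> N (right_translate h u).

Lemma hull_inj (u v : hull N) : (forall g j, u g j = v g j) -> u = v.
Proof.
case: u v => [u uP] [v vP] /= uv.
have {}uv : u = v by apply/funext => g; apply/funext => j.
by case: _ / uv vP => vP; congr Hull; exact: Prop_irrelevance.
Qed.

HB.instance Definition _ := gen_eqMixin (hull N).
HB.instance Definition _ := gen_choiceMixin (hull N).

Definition hull_dist (u v : hull N) : R :=
  psup setT (fun gj : G * J => `|u gj.1 gj.2 - v gj.1 gj.2|).

Lemma hull01 (u : hull N) g j : 0 <= u g j <= 1.
Proof. by have [] := hullP u. Qed.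

Lemma hull_dist_ub (u v : hull N) g j : `|u g j - v g j| <= hull_dist u v.
Proof.
apply: (psup_ub (f := fun gj : G * J => `|u gj.1 gj.2 - v gj.1 gj.2|)
  (i := (g, j))) => // -[g' j'] _ /=.
have /andP[? ?] := hull01 u g' j'; have /andP[? ?] := hull01 v g' j'.
by rewrite ler_norml; apply/andP; split; lra.
Qed.

Lemma hull_dist_le (u v : hull N) e : 0 <= e ->
  (forall g j, `|u g j - v g j| <= e) -> hull_dist u v <= e.
Proof. by move=> e0 uv; apply: psup_le => // -[g j] _; exact: uv. Qed.

Let hull_distxx u : hull_dist u u = 0.
Proof.
apply/eqP; rewrite eq_le psup_ge0 andbT; apply: hull_dist_le => // g j.
by rewrite subrr normr0.
Qed.

Let hull_dist_positivity u v : hull_dist u v = 0 -> u = v.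
Proof.
move=> uv; apply: hull_inj => g j; apply/eqP; rewrite -subr_eq0 -normr_le0.
by rewrite -uv; exact: hull_dist_ub.
Qed.

Let hull_dist_sym u v : hull_dist u v = hull_dist v u.
Proof. by congr psup; apply/funext => gj; rewrite distrC. Qed.

Let hull_dist_triangle v u w :
  hull_dist u w <= hull_dist u v + hull_dist v w.
Proof.
apply: hull_dist_le => [|g j]; first by rewrite addr_ge0 // psup_ge0.
have -> : u g j - w g j = (u g j - v g j) + (v g j - w g j) by ring.
by apply: le_trans (ler_normD _ _) _; apply: lerD; exact: hull_dist_ub.
Qed.

HB.instance Definition _ := @isMetric.Build R (hull N) hull_dist
  hull_distxx hull_dist_positivity hull_dist_sym hull_dist_triangle.

Lemma hull_mdistE (u v : hull N) : mdist u v = hull_dist u v.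
Proof. by []. Qed.

Lemma hull_nearP (u : hull N) (e : R) : 0 < e ->
  nbhs u [set v | hull_dist u v <= e].
Proof.
move=> e0; have := nbhsx_ballx u e e0; rewrite ballEmdist.
by apply: filterS => v /ltW.
Qed.

Lemma continuous_hullP (E : topologicalType) (f : E -> hull N) :
  (forall x (e : R), 0 < e -> \forall y \near x, hull_dist (f x) (f y) <= e) ->
  continuous f.
Proof.
move=> h x B; rewrite -nbhs_ballE => -[e /= e0]; rewrite ballEmdist => eB.
have e2 : 0 < e / 2 by rewrite divr_gt0.
apply: filterS (h x _ e2) => y xy; apply: eB => /=; rewrite hull_mdistE.
by apply: le_lt_trans xy _; lra.
Qed.

Let in_hull_translate h u : in_hull N u -> in_hull N (right_translate h u).
Proof.
move=> [u01 uc uN]; split.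
- by move=> g j; exact: u01.
- move=> g _ e e0.
  have cm : continuous (fun g : G => (g * h)%g).
    apply: (continuous_compose (f := fun g : G => (g, h))
      (g := fun gh : G * G => (gh.1 * gh.2)%g)); last exact: mulg_continuous.
    by apply: continuous_pair => z; [exact: cvg_id|exact: cvg_cst].
  have P : \forall k \near g, forall j, `|u (g * h)%g j - u (k * h)%g j| <= e.
    apply: (cm g [set k | forall j, `|u (g * h)%g j - u k j| <= e]).
    by have := uc (g * h)%g Logic.I e e0; apply: filterS => k; exact.
  by apply: filterS P => k kP _ j; exact: kP.
case: uN => [uN|[c c0 uc']]; [left; exact: Ninv|right].
by exists c => // g j; exact: uc'.
Qed.

Definition hull_act (h : G) (u : hull N) : hull N :=
  Hull (in_hull_translate h (hullP u)).

Let hull_act1 u : hull_act 1%g u = u.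
Proof. by apply: hull_inj => g j /=; rewrite /right_translate mulg1. Qed.

Let hull_actM g h u : hull_act (g * h)%g u = hull_act g (hull_act h u).
Proof. by apply: hull_inj => k j /=; rewrite /right_translate mulgA. Qed.

(** Translations do not increase the supremum distance, so it is enough to vary [h] for a fixed [u];
    there equicontinuity of [u] is made uniform over [G] by compactness. *)
Let hull_act_continuous :
  continuous (fun gu : G * hull N => hull_act gu.1 gu.2).
Proof.
apply: continuous_hullP => -[h u] e e0 /=.
have e4 : 0 < e / 4 by rewrite divr_gt0.
have uh : \forall k \near h, [set: G] `<=` (fun g => forall j,
    `|u (g * h)%g j - u (g * k)%g j| <= e / 2).
  move/compact_near_coveringP: cG; apply => g _.
  have [_ uc _] := hullP u.
  have gP : nbhs (g * h)%g [set k | forall j, `|u (g * h)%g j - u k j| <= e / 4].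
    by have := uc (g * h)%g Logic.I _ e4; apply: filterS => k; exact.
  have [[U V] [/= gU hV] UV] := mulg_continuous (g, h) _ gP.
  exists (U, V) => // -[g' k] [/= Ug' Vk] j.
  have := UV (g', k) (conj Ug' Vk) j.
  have := UV (g', h) (conj Ug' (nbhs_singleton hV)) j.
  rewrite /= !ler_norml => /andP[? ?] /andP[? ?].
  by apply/andP; split; lra.
have e2 : 0 < e / 2 by rewrite divr_gt0.
exists ([set k | [set: G] `<=` (fun g => forall j,
    `|u (g * h)%g j - u (g * k)%g j| <= e / 2)],
  [set v | hull_dist u v <= e / 2]).
  by split => //=; exact: hull_nearP.
move=> [k v] [/= kP vP]; apply: hull_dist_le => [|g j]; first exact: ltW.
rewrite /= /right_translate.
have := kP g Logic.I j; have := hull_dist_ub u v (g * k)%g j.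
move: vP; rewrite !ler_norml => ? /andP[? ?] /andP[? ?].
by apply/andP; split; lra.
Qed.

Definition hull_gspace : gspace G :=
  GSpace hull_act1 hull_actM hull_act_continuous.

(** The extension [F] need not stay in [N], so it is raised to at least the distance [d] from [A].
    Where [d] is positive, the function is bounded away from 0; where [d] vanishes, attainment gives
    a point of [A] at distance 0, and the function is a value of [f]. *)
Lemma hull_AE : hausdorff_space G -> equivariant_AE R hull_gspace.
Proof.
move=> hG H i E A f cH ppE clA Ainv cf fi.
have cg (x : E) g e : A x -> 0 < e -> \forall y \near (x, g), (A `*` setT) y ->
    forall j, `|f x g j - f y.1 y.2 j| <= e.
  move=> Ax e0; have e2 : 0 < e / 2 by rewrite divr_gt0.
  have [_ uc _] := hullP (f x).
  exists ([set y | A y -> hull_dist (f x) (f y) <= e / 2],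
    [set k | forall j, `|f x g j - f x k j| <= e / 2]).
    split => /=; last first.
      by have := uc g Logic.I _ e2; apply: filterS => k; exact.
    exact: (within_continuous_near cf Ax (hull_nearP (f x) e2)).
  move=> [y k] [/= yP kP] [/= Ay _] j.
  have := kP j; have := hull_dist_ub (f x) (f y) k j; have := yP Ay.
  rewrite !ler_norml => ? /andP[? ?] /andP[? ?].
  by apply/andP; split; lra.
have [|||F [D [[DP Dinv] att [Ff F01] Finv [FD Fc]]]] :=
  @equivariant_extension R H G i cH cG hG E A J (fun x => f x) ppE clA Ainv.
- by move=> x g j _; exact: hull01.
- by move=> [x g] [/= Ax _] e e0; exact: cg.
- by move=> h x g j Ax; rewrite fi.
have [D01 Dxx Ds Dt Dc] := DP.
(* The infimum of [D x a] over [A], written so that it is 1 when [A] is empty. *)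
pose d x := 1 - psup A (fun a => 1 - D x a).
have D1 x a : A a -> 1 - D x a <= 1.
  by move=> _; have /andP[? _] := D01 x a; lra.
have d01 x : 0 <= d x <= 1.
  have h := psup_ge0 A (fun a => 1 - D x a).
  have : psup A (fun a => 1 - D x a) <= 1 by apply: psup_le => // a; exact: D1.
  by rewrite /d => ?; apply/andP; split; lra.
have dA x : A x -> d x = 0.
  move=> Ax; have /andP[d0 _] := d01 x; apply/eqP; rewrite eq_le d0 andbT.
  have := psup_ub (D1 x) Ax; rewrite Dxx /d; lra.
have dD x y : `|d x - d y| <= D x y.
  have -> : d x - d y = psup A (fun a => 1 - D y a) - psup A (fun a => 1 - D x a).
    by rewrite /d; ring.
  apply: psup_dist => [a|a| |a Aa]; [exact: D1|exact: D1|by case/andP: (D01 x y)|].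
  have := Dt x y a; have := Dt y x a; rewrite (Ds y x) ler_norml => ? ?.
  by apply/andP; split; lra.
have dinv h x : d (gact h x) = d x.
  have dle k y : d (gact k y) <= d y.
    rewrite /d lerD2l lerN2; apply: psup_le; first exact: psup_ge0.
    move=> a Aa; rewrite -(Dinv k y a).
    exact: (psup_ub (D1 (gact k y)) (Ainv k _ Aa)).
  apply/eqP; rewrite eq_le dle /=.
  by have := dle (h^-1)%g (gact h x); rewrite -gactM mulVg gact1.
pose Phi x g j := Num.max (F x g j) (d x).
have PhiE x a : A a -> D x a = 0 -> Phi x = f a.
  move=> Aa xa; apply/funext => g; apply/funext => j; rewrite /Phi.
  have := dD x a; rewrite xa (dA a Aa) subr0 normr_le0 => /eqP ->.
  have := FD x a g j; rewrite xa normr_le0 subr_eq0 => /eqP ->.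
  by rewrite Ff //; apply/max_idPl; case/andP: (hull01 (f a) g j).
have PhiP x : in_hull N (Phi x).
  split.
  - move=> g j; rewrite /Phi le_max ge_max; case/andP: (F01 x g j) => -> -> /=.
    by case/andP: (d01 x).
  - move=> g _ e e0.
    have := Fc x g Logic.I e e0; apply: filterS => k kP _ j.
    have := kP Logic.I j; rewrite /Phi !ler_norml => /andP[? ?].
    case: (leP (F x g j) (d x)) => ?; case: (leP (F x k j) (d x)) => ?;
      by apply/andP; split; lra.
  have [d0|d0] := ltP 0 (d x).
    by right; exists (d x) => // g j; rewrite /Phi le_max lexx orbT.
  have [a Aa xa] : exists2 a, A a & D x a = 0.
    apply: att => e e0.
    (* The cap at 1 keeps the level nonnegative, as [psup_gt] asks. *)
    have [a Aa] : exists2 a, A a & 1 - Num.min e 1 < 1 - D x a.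
      apply: psup_gt; first by rewrite subr_ge0 ge_min lexx orbT.
      have : 0 < Num.min e 1 by rewrite lt_min e0 ltr01.
      by move: d0; rewrite /d; lra.
    rewrite ltrD2l ltrN2 lt_min => /andP[/ltW ? _].
    by exists a.
  by rewrite (PhiE x a) //; have [] := hullP (f a).
exists (fun x => Hull (PhiP x)); split.
- apply: continuous_hullP => x e e0.
  apply: filterS (Dc x e e0) => y xy; apply: hull_dist_le => [|g j /=].
    exact: ltW.
  apply: le_trans xy; rewrite /Phi; have := FD x y g j; have := dD x y.
  rewrite !ler_norml => /andP[? ?] /andP[? ?].
  case: (leP (F x g j) (d x)) => ?; case: (leP (F y g j) (d y)) => ?;
    by apply/andP; split; lra.
- by move=> h x; apply: hull_inj => g j /=; rewrite /right_translate /Phi Finv dinv.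
- move=> x Ax; apply: hull_inj => g j /=.
  by rewrite (PhiE x x).
Qed.

End hull.

(** * The compact extensor: a cube of Lipschitz functions on G *)

Lemma ptws_cvgP (I : Type) (V : topologicalType)
    (F : set_system {ptws I -> V}) (u : {ptws I -> V}) : Filter F ->
  F --> u <-> forall i, (fun v : {ptws I -> V} => v i) @ F --> u i.
Proof.
move=> FF; split=> [Fu i B nB|Fu].
  have Fi := (cvg_sup _ _ _).1 Fu i.
  apply: Fi; exact: (@initial_continuous (I -> V) V (fun v => v i) u B nB).
apply/cvg_sup => i B [_ [[W oW <-] /= Wu] WB].
by apply: (filterS WB); apply: (Fu i W); exact: open_nbhs_nbhs.
Qed.

(** A continuous right-invariant pseudometric on [G], given by its distance to the identity: the
    distance of [g] and [h] is the length of [g * h^-1]. *)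
Record length_function (R : realType) (G : topologicalGroupType) :=
  LengthFunction {
  len_fun :> G -> R;
  len_continuous : continuous len_fun;
  len1 : len_fun 1%g = 0;
  lenV : forall g, len_fun (g^-1)%g = len_fun g;
  lenM : forall g h, len_fun (g * h)%g <= len_fun g + len_fun h
}.

Lemma len_ge0 (R : realType) (G : topologicalGroupType)
  (k : length_function R G) g : 0 <= k g.
Proof. by have := lenM k g (g^-1)%g; rewrite mulgV len1 lenV; lra. Qed.

Section lipschitz_cube.
Context {R : realType} {G : topologicalGroupType} {S : Type}.
Context (k : S -> length_function R G).

(** One fixed modulus [k s] per coordinate survives pointwise limits, which gives compactness, and
    makes the action continuous for the pointwise topology. The increment [h] stands on the left,
    where right translation does not touch it. *)
Definition in_lipschitz_cube : set {ptws (S * G)%type -> R} :=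
  [set u | (forall s g, 0 <= u (s, g) <= 1) /\
    (forall s g h, `|u (s, (h * g)%g) - u (s, g)| <= k s h)].

Definition lipschitz_cube : topologicalType := set_type in_lipschitz_cube.

Definition cube_fun (u : lipschitz_cube) (s : S) (g : G) : R :=
  (set_val u : S * G -> R) (s, g).

Lemma cube01 u s g : 0 <= cube_fun u s g <= 1.
Proof. by have [h _] := set_valP u; exact: h. Qed.

Lemma cube_lip u s g h :
  `|cube_fun u s (h * g)%g - cube_fun u s g| <= k s h.
Proof. by have [_ +] := set_valP u; exact. Qed.

Definition Cube (u : S -> G -> R) (u01 : forall s g, 0 <= u s g <= 1)
    (ul : forall s g h, `|u s (h * g)%g - u s g| <= k s h) : lipschitz_cube :=
  SigSub (mem_set (conj u01 ul : in_lipschitz_cube (fun sg => u sg.1 sg.2))).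

Lemma cube_inj u v : (forall s g, cube_fun u s g = cube_fun v s g) -> u = v.
Proof.
by move=> uv; apply: val_inj; apply/funext => -[s g]; exact: uv.
Qed.

Lemma cube_cvgP (F : set_system lipschitz_cube) (u : lipschitz_cube) :
  Filter F -> (forall s g, (fun v => cube_fun v s g) @ F --> cube_fun u s g) ->
  F --> u.
Proof.
move=> FF Fu.
have Fval : (set_val : lipschitz_cube -> {ptws (S * G)%type -> R}) @ F --> set_val u.
  by apply/ptws_cvgP => -[s g]; exact: Fu.
move=> B [_ [[W oW <-] /= Wu] WB].
by apply: (filterS WB); apply: (Fval W); exact: open_nbhs_nbhs.
Qed.

Lemma cube_fun_continuous s g : continuous (fun u => cube_fun u s g).
Proof.
move=> u.
have : (set_val : lipschitz_cube -> {ptws (S * G)%type -> R}) @ nbhs u --> set_val u.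
  exact: set_val_continuous.
by move=> /ptws_cvgP/(_ (s, g)).
Qed.

Lemma continuous_cubeP (E : topologicalType) (f : E -> lipschitz_cube) :
  (forall s g, continuous (fun x => cube_fun (f x) s g)) -> continuous f.
Proof. by move=> cf x; apply: cube_cvgP => s g; exact: cf. Qed.

Lemma cube_hausdorff : hausdorff_space lipschitz_cube.
Proof.
move=> u v uv; apply: cube_inj => s g.
apply: (@Rhausdorff R) => A B nA nB.
have [w [Aw Bw]] := uv _ _ (cube_fun_continuous nA) (cube_fun_continuous nB).
by exists (cube_fun w s g).
Qed.

(** An ultrafilter converges in every coordinate, and the inequalities that define the cube pass to
    the limit. *)
Lemma cube_compact : compact [set: lipschitz_cube].
Proof.
rewrite compact_ultra => F FU _; have FF : ProperFilter F by exact: ultra_proper.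
have /choice[l lP] : forall sg : S * G, exists l : R,
    (fun v => cube_fun v sg.1 sg.2) @ F --> l.
  move=> [s g] /=.
  have := @segment_compact R 0 1; rewrite compact_ultra.
  move=> /(_ _ (ultra_fmap (fun v => cube_fun v s g) FU))[|l [_ Fl]].
    change (F ((fun v => cube_fun v s g) @^-1` `[0, 1])).
    by apply: filterE => v; rewrite /= in_itv /=; exact: cube01.
  by exists l.
have lim_ge0 (p : lipschitz_cube -> R) (c : R) : (forall v, 0 <= p v) ->
    p @ F --> c -> 0 <= c.
  by move=> p0 pc; apply: (cvgr_to_ge pc); exact: nearW.
have l01 s g : 0 <= l (s, g) <= 1.
  apply/andP; split; first by apply: lim_ge0 (lP (s, g)) => v; case/andP: (cube01 v s g).
  rewrite -subr_ge0; apply: (lim_ge0 (fun v => 1 - cube_fun v s g)).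
    by move=> v; rewrite subr_ge0; case/andP: (cube01 v s g).
  by apply: cvgB; [exact: cvg_cst|exact: (lP (s, g))].
have ll s g h : `|l (s, (h * g)%g) - l (s, g)| <= k s h.
  rewrite -subr_ge0.
  apply: (lim_ge0 (fun v => k s h - `|cube_fun v s (h * g)%g - cube_fun v s g|)).
    by move=> v; rewrite subr_ge0; exact: cube_lip.
  apply: cvgB; first exact: cvg_cst.
  by apply: cvg_norm; apply: cvgB; [exact: (lP (s, (h * g)%g))|exact: (lP (s, g))].
exists (Cube (u := fun s g => l (s, g)) l01 ll); split => //.
by apply: cube_cvgP => s g; exact: (lP (s, g)).
Qed.

Definition cube_act (h : G) (u : lipschitz_cube) : lipschitz_cube.
Proof.
refine (@Cube (fun s g => cube_fun u s (g * h)%g) _ _).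
- by move=> s g; exact: cube01.
- by move=> s g h'; rewrite -mulgA; exact: cube_lip.
Defined.

Lemma cube_actE h u s g : cube_fun (cube_act h u) s g = cube_fun u s (g * h)%g.
Proof. by []. Qed.

Let cube_act1 u : cube_act 1%g u = u.
Proof. by apply: cube_inj => s g; rewrite cube_actE mulg1. Qed.

Let cube_actM g h u : cube_act (g * h)%g u = cube_act g (cube_act h u).
Proof.
by apply: cube_inj => s x; rewrite !cube_actE mulgA.
Qed.

Let cube_translate_near s g (e : R) : 0 < e -> \forall h \near g,
  forall u : lipschitz_cube, `|cube_fun u s g - cube_fun u s h| <= e.
Proof.
move=> e0.
have cq : continuous (fun h : G => k s (h * g^-1)%g).
  apply: (continuous_compose (g := k s) (f := fun h : G => (h * g^-1)%g)).
    apply: (continuous_compose (f := fun h : G => (h, g^-1%g))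
      (g := fun gh : G * G => (gh.1 * gh.2)%g)); last exact: mulg_continuous.
    by apply: continuous_pair => z; [exact: cvg_id|exact: cvg_cst].
  exact: len_continuous.
have := (continuous_distP _).1 cq g e e0; apply: filterS => h.
rewrite mulgV len1 sub0r normrN ger0_norm ?len_ge0 // => hg u.
by rewrite distrC; have := cube_lip u s g (h * g^-1)%g; rewrite mulgVK => /le_trans; apply.
Qed.

Let cube_act_continuous :
  continuous (fun gu : G * lipschitz_cube => cube_act gu.1 gu.2).
Proof.
apply: continuous_cubeP => s g; apply/continuous_distP => -[h u] e e0.
have e2 : 0 < e / 2 by rewrite divr_gt0.
have cm : continuous (fun h : G => (g * h)%g).
  apply: (continuous_compose (f := fun h : G => (g, h))
    (g := fun gh : G * G => (gh.1 * gh.2)%g)); last exact: mulg_continuous.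
  by apply: continuous_pair => z; [exact: cvg_cst|exact: cvg_id].
exists ([set h' | forall v : lipschitz_cube,
    `|cube_fun v s (g * h)%g - cube_fun v s (g * h')%g| <= e / 2],
  [set v | `|cube_fun u s (g * h)%g - cube_fun v s (g * h)%g| <= e / 2]).
  split => /=.
    exact: (cm h _ (cube_translate_near s (g * h)%g e2)).
  exact: ((continuous_distP _).1 (@cube_fun_continuous s (g * h)%g) u _ e2).
move=> [h' v] [/= h'P vP]; have := h'P v; move: vP.
rewrite !cube_actE !ler_norml => /andP[? ?] /andP[? ?].
by apply/andP; split; lra.
Qed.

Definition cube_gspace : gspace G :=
  GSpace cube_act1 cube_actM cube_act_continuous.

(** The topology is pointwise, so each coordinate [s] can be extended with a pseudometric of its
    own. The extension may violate the modulus [k s]; a second sup-convolution, along left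
    translates in [G], restores it. It commutes with right translation and changes nothing over
    [A]. *)
Lemma cube_AE : compact [set: G] -> hausdorff_space G ->
  equivariant_AE R cube_gspace.
Proof.
move=> cG hG H i E A f cH ppE clA Ainv cf fi.
pose f0 s x g (_ : unit) := cube_fun (f x) s g.
have /choice[F FP] : forall s, exists FD : (E -> G -> unit -> R) * (E -> E -> R),
    [/\ pseudometric_cont FD.2,
      forall x g j, A x -> FD.1 x g j = f0 s x g j,
      forall x g j, 0 <= FD.1 x g j <= 1,
      forall h x g j, FD.1 (gact h x) g j = FD.1 x (g * i h)%g j
    & forall x y g j, `|FD.1 x g j - FD.1 y g j| <= FD.2 x y].
  move=> s.
  have [|||F [D [[DP _] _ [Ff F01] Finv [FD _]]]] :=
    @equivariant_extension R H G i cH cG hG E A unit (f0 s) ppE clA Ainv.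
  - by move=> x g j _; exact: cube01.
  - move=> [x g] [/= Ax _] e e0; have e2 : 0 < e / 2 by rewrite divr_gt0.
    exists ([set y | A y -> `|cube_fun (f x) s g - cube_fun (f y) s g| <= e / 2],
      [set h | forall v : lipschitz_cube,
        `|cube_fun v s g - cube_fun v s h| <= e / 2]).
      split => /=; last exact: cube_translate_near.
      apply: (within_continuous_near
        (B := [set v | `|cube_fun (f x) s g - cube_fun v s g| <= e / 2]) cf Ax).
      exact: ((continuous_distP _).1 (@cube_fun_continuous s g) (f x) _ e2).
    move=> [y h] [/= yP hP] [/= Ay _] j; have := hP (f y); have := yP Ay.
    rewrite /f0 !ler_norml => /andP[? ?] /andP[? ?].
    by apply/andP; split; lra.
  - by move=> h x g j Ax; rewrite /f0 fi.
  by exists (F, D).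
have F1 s x g j : (F s).1 x g j <= 1 by have [_ _ /(_ x g j)/andP[]] := FP s.
have Fk1 s x g y : (F s).1 x (y * g)%g tt - k s y <= 1.
  by have := F1 s x (y * g)%g tt; have := len_ge0 (k s) y; lra.
pose F2 x s g := psup setT (fun y => (F s).1 x (y * g)%g tt - k s y).
have F201 x s g : 0 <= F2 x s g <= 1 by rewrite psup_ge0 psup_le.
have F2le x s g h : F2 x s (h * g)%g <= F2 x s g + k s h.
  apply: psup_le; first by rewrite addr_ge0 ?psup_ge0 ?len_ge0.
  move=> y _; have := psup_ub (P := setT) (i := (y * h)%g) (fun y _ => Fk1 s x g y) Logic.I.
  by rewrite -/(F2 x s g) mulgA; have := lenM (k s) y h; lra.
have F2lip x s g h : `|F2 x s (h * g)%g - F2 x s g| <= k s h.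
  have := F2le x s g h; have := F2le x s (h * g)%g (h^-1)%g.
  rewrite mulgA mulVg mul1g lenV ler_norml => ? ?.
  by apply/andP; split; lra.
exists (fun x => Cube (F201 x) (F2lip x)); split.
- apply: continuous_cubeP => s g; apply/continuous_distP => x e e0.
  have [[D01 _ _ _ Dc] _ _ _ FD] := FP s.
  apply: filterS (Dc x e e0) => y xy; apply: le_trans xy.
  apply: psup_dist => [y' _|y' _| |y' _]; [exact: Fk1|exact: Fk1| |].
    by case/andP: (D01 x y).
  by rewrite opprB addrA subrK.
- move=> h x; apply: cube_inj => s g; rewrite /cube_fun /= /F2.
  congr psup; apply/funext => y; have [_ _ _ Finv _] := FP s.
  by rewrite Finv mulgA.
- move=> x Ax; apply: cube_inj => s g; rewrite {1}/cube_fun /=.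
  have [_ Ff _ _ _] := FP s.
  apply/eqP; rewrite eq_le; apply/andP; split.
    apply: psup_le; first by case/andP: (cube01 (f x) s g).
    move=> y _; rewrite Ff // /f0; have := cube_lip (f x) s g y.
    by rewrite ler_norml => /andP[? ?]; lra.
  have := psup_ub (P := setT) (i := 1%g) (fun y _ => Fk1 s x g y) Logic.I.
  by rewrite mul1g len1 subr0 Ff.
Qed.

End lipschitz_cube.

Section gprod.
Context (G : topologicalGroupType) (Y Z : gspace G).

Let prod_act (g : G) (u : Y * Z) : Y * Z := (gact g u.1, gact g u.2).

Let prod_act1 u : prod_act 1%g u = u.
Proof. by case: u => y z; rewrite /prod_act /= !gact1. Qed.

Let prod_actM g h u : prod_act (g * h)%g u = prod_act g (prod_act h u).
Proof. by rewrite /prod_act /= !gactM. Qed.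

Let prod_act_continuous :
  continuous (fun gu : G * (Y * Z)%type => prod_act gu.1 gu.2).
Proof.
apply: continuous_pair.
  apply: (continuous_compose (f := fun u : G * (Y * Z) => (u.1, u.2.1))
    (g := fun gy : G * Y => gact gy.1 gy.2)); last exact: gact_continuous.
  apply: continuous_pair; first exact: fst_continuous.
  exact: (continuous_compose (@snd_continuous _ _) (@fst_continuous _ _)).
apply: (continuous_compose (f := fun u : G * (Y * Z) => (u.1, u.2.2))
  (g := fun gy : G * Z => gact gy.1 gy.2)); last exact: gact_continuous.
apply: continuous_pair; first exact: fst_continuous.
exact: (continuous_compose (@snd_continuous _ _) (@snd_continuous _ _)).
Qed.

Definition gprod : gspace G := GSpace prod_act1 prod_actM prod_act_continuous.

Lemma gprod_AE (R : realType) : equivariant_AE R Y -> equivariant_AE R Z ->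
  equivariant_AE R gprod.
Proof.
move=> aY aZ H i E A f cH ppE clA Ainv cf fi.
have [|F [cF Fi Ff]] := aY H i E A (fst \o f) cH ppE clA Ainv _
    (fun h x Ax => congr1 fst (fi h x Ax)).
  exact: (@continuous_compose (subspace A) _ _ f fst cf (@fst_continuous _ _)).
have [|F' [cF' Fi' Ff']] := aZ H i E A (snd \o f) cH ppE clA Ainv _
    (fun h x Ax => congr1 snd (fi h x Ax)).
  exact: (@continuous_compose (subspace A) _ _ f snd cf (@snd_continuous _ _)).
exists (fun x => (F x, F' x)); split.
- exact: continuous_pair.
- by move=> h x; rewrite Fi Fi'.
- by move=> x Ax; rewrite Ff // Ff' //=; case: (f x).
Qed.

End gprod.

(** * Right-invariant pseudometrics and functions Lipschitz along orbits *)

Section length_functions.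
Context {R : realType} {G : topologicalGroupType}.
Hypothesis cG : compact [set: G].

Lemma pseudometric_cont_fun (E : topologicalType) (f : E -> R) : continuous f ->
  (forall x, 0 <= f x <= 1) -> pseudometric_cont (fun x y => `|f x - f y|).
Proof.
move=> cf f01; split.
- move=> x y; rewrite normr_ge0 /=.
  have /andP[? ?] := f01 x; have /andP[? ?] := f01 y.
  by rewrite ler_norml; apply/andP; split; lra.
- by move=> x; rewrite subrr normr0.
- by move=> x y; rewrite distrC.
- move=> x y z; have -> : f x - f z = (f x - f y) + (f y - f z) by ring.
  exact: ler_normD.
- exact/continuous_distP.
Qed.

(** From a Urysohn function [u] that is 0 at the identity and 1 off [V], the supremum over [x] of
    the differences of [u (g * x)] and [u (h * x)] is a right-invariant continuous pseudometric. *)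
Lemma length_function_separates (V : set G) : hausdorff_space G -> open V ->
  V 1%g -> exists k : length_function R G, forall g, ~ V g -> 1 <= k g.
Proof.
move=> hG oV V1.
have cl1 : closed [set 1%g : G].
  exact/accessible_closed_set1/hausdorff_accessible.
have [|u [cu u01 u0 u1]] := normal_urysohn R (compact_normal hG cG)
    cl1 (open_closedC oV).
  by apply/seteqP; split => // g [/= -> nV]; exact: nV.
have cm : continuous (fun xg : G * G => (xg.2 * xg.1)%g).
  apply: (continuous_compose (f := fun xg : G * G => (xg.2, xg.1))
    (g := fun gh : G * G => (gh.1 * gh.2)%g)); last exact: mulg_continuous.
  by apply: continuous_pair; [exact: snd_continuous|exact: fst_continuous].
have DP := pseudometric_cont_psup_compact cG cm (pseudometric_cont_fun cu u01).
pose D g h := psup setT (fun x => `|u (g * x)%g - u (h * x)%g|).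
have [D01 Dxx Ds Dt Dc] : pseudometric_cont D by exact: DP.
have Dle g h x : D (g * x)%g (h * x)%g <= D g h.
  apply: psup_le => [|y _]; first exact: psup_ge0.
  rewrite -!mulgA; apply: (psup_ub (f := fun x => `|u (g * x)%g - u (h * x)%g|)) => //.
  by move=> z _; have [/(_ (g * z)%g (h * z)%g)/andP[]] := pseudometric_cont_fun cu u01.
have Dinv g h x : D (g * x)%g (h * x)%g = D g h.
  apply/eqP; rewrite eq_le Dle /=.
  by have := Dle (g * x)%g (h * x)%g (x^-1)%g; rewrite !mulgK.
have ck : continuous (D^~ 1%g).
  apply/continuous_distP => g e e0; apply: filterS (Dc g e e0) => h gh.
  have := Dt g h 1%g; have := Dt h g 1%g; rewrite (Ds h g) ler_norml => ? ?.
  by apply/andP; split; lra.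
have kV g : D (g^-1)%g 1%g = D g 1%g.
  by rewrite -(Dinv _ _ g) mulVg mul1g Ds.
have kM g h : D (g * h)%g 1%g <= D g 1%g + D h 1%g.
  by have := Dt (g * h)%g h 1%g; rewrite -{3}(mul1g h) Dinv.
exists (LengthFunction ck (Dxx 1%g) kV kM) => g nVg /=.
have <- : `|u (g * 1)%g - u (1 * 1)%g| = 1.
  by rewrite !mulg1 u1 // u0 // subr0 normr1.
apply: (psup_ub (f := fun x => `|u (g * x)%g - u (1 * x)%g|)) => //.
by move=> z _; have [/(_ (g * z)%g (1 * z)%g)/andP[]] := pseudometric_cont_fun cu u01.
Qed.

Context (X : gspace G).

Record orbit_lipschitz := OrbitLipschitz {
  ol_fun :> X -> R;
  ol_len : length_function R G;
  ol_continuous : continuous ol_fun;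
  ol01 : forall x, 0 <= ol_fun x <= 1;
  ol_lip : forall g x, `|ol_fun (gact g x) - ol_fun x| <= ol_len g
}.

(** A function [p] separating [x] from [y] is made Lipschitz along orbits by sup-convolution with a
    length [k]. This keeps the value 1 at [x]. At [y] the value is at most one half: either
    [p (gact g y) < 1 / 2], or [k g >= 1] cancels it. *)
Lemma orbit_lipschitz_separates x y : hausdorff_space G -> p_paracompact R X ->
  x <> y -> exists f : orbit_lipschitz, f x <> f y.
Proof.
move=> hG ppX xy; have [hX _] := ppX.
have cl z : closed [set z : X] by exact/accessible_closed_set1/hausdorff_accessible.
have [|p [cp p01 py px]] := normal_urysohn R (p_paracompact_normal ppX) (cl y) (cl x).
  by apply/seteqP; split => // z [/= -> yx]; apply: xy.
have cpy : continuous (fun g : G => p (gact g y)).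
  apply: (continuous_compose (f := fun g : G => gact g y)) => //.
  apply: (continuous_compose (f := fun g : G => (g, y))
    (g := fun gx : G * X => gact gx.1 gx.2)); last exact: gact_continuous.
  by apply: continuous_pair => z; [exact: cvg_id|exact: cvg_cst].
pose V := [set g : G | p (gact g y) < 1 / 2].
have oV : open V by exact: (open_comp (fun g _ => cpy g) (@open_lt _ (1 / 2))).
have [|k kV] := length_function_separates hG oV.
  by rewrite /V /= gact1 py //; lra.
pose q z := psup setT (fun g => p (gact g z) - k g).
have pk1 z g : p (gact g z) - k g <= 1.
  by have /andP[_ ?] := p01 (gact g z); have := len_ge0 k g; lra.
have q01 z : 0 <= q z <= 1 by rewrite psup_ge0 psup_le.
have cq : continuous q.
  apply/continuous_distP => z e e0.
  have [_ _ _ _ Dc] := pseudometric_cont_psup_compact cG (@gact_continuous G X)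
    (pseudometric_cont_fun cp p01).
  apply: filterS (Dc z e e0) => w /=; apply: le_trans.
  apply: psup_dist => // [|g _]; first exact: psup_ge0.
  have -> : p (gact g z) - k g - (p (gact g w) - k g) = p (gact g z) - p (gact g w).
    by ring.
  apply: (psup_ub (f := fun g => `|p (gact g z) - p (gact g w)|)) => // h _.
  by have [/(_ (gact h z) (gact h w))/andP[]] := pseudometric_cont_fun cp p01.
have qle h z : q (gact h z) <= q z + k h.
  apply: psup_le; first by rewrite addr_ge0 ?psup_ge0 ?len_ge0.
  move=> g _; have := psup_ub (P := setT) (i := (g * h)%g) (fun g _ => pk1 z g) Logic.I.
  by rewrite -/(q z) gactM; have := lenM k g h; lra.
have qlip h z : `|q (gact h z) - q z| <= k h.
  have := qle h z; have := qle (h^-1)%g (gact h z).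
  rewrite -gactM mulVg gact1 lenV ler_norml => ? ?.
  by apply/andP; split; lra.
exists (OrbitLipschitz cq q01 qlip) => /= qxy.
have : q y <= 1 / 2.
  apply: psup_le => [|g _]; first by lra.
  have [Vg|nVg] := pselect (V g).
    by move: Vg; rewrite /V /=; have := len_ge0 k g; lra.
  by have := kV g nVg; have /andP[_ ?] := p01 (gact g y); lra.
have := psup_ub (P := setT) (i := 1%g) (fun g _ => pk1 x g) Logic.I.
by rewrite -/(q x) gact1 px // len1 qxy; lra.
Qed.

End length_functions.

(** * Closed equivariant embedding into an extensor *)

Section embedding.
Context {R : realType} {G : topologicalGroupType}.
Hypotheses (cG : compact [set: G]) (hG : hausdorff_space G).
Context (X : gspace G) (M : metricType R) (p : X -> M).
Hypotheses (ppX : p_paracompact R X) (pp : perfect_map p).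

(** The Kuratowski embedding of [M] by truncated distance functions, applied along the orbit of
    [x]. *)
Let psi (x : X) : G -> M -> R := fun g m => Num.min 1 (mdist (p (gact g x)) m).
Let N : set (G -> M -> R) := range psi.

Let psi_translate h x : right_translate h (psi x) = psi (gact h x).
Proof.
apply/funext => g; apply/funext => m.
by rewrite /right_translate /psi gactM.
Qed.

Let Ninv h u : N u -> N (right_translate h u).
Proof. by move=> [x _ <-]; exists (gact h x). Qed.

Let min_lip (a b m : M) :
  `|Num.min 1 (mdist a m) - Num.min 1 (mdist b m)| <= Num.min 1 (mdist a b).
Proof.
have := metric_triangle a b m; have := metric_triangle b a m.
have := mdist_ge0 a m; have := mdist_ge0 b m; rewrite [mdist b a]metric_sym.
rewrite ler_norml; case: (leP 1 (mdist a m)) => ?;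
  case: (leP 1 (mdist b m)) => ?; case: (leP 1 (mdist a b)) => ? ? ? ? ?;
  by apply/andP; split; lra.
Qed.

Let cp : continuous p. Proof. by case: pp. Qed.

Let DP := pseudometric_cont_metric cp.

Let psiP x : in_hull N (psi x).
Proof.
split; last by left; exists x.
- by move=> g m; rewrite /psi le_min ler01 mdist_ge0 ge_min lexx.
- move=> g _ e e0; have [_ _ _ _ Dc] := DP.
  have cx : continuous (fun g : G => gact g x).
    apply: (continuous_compose (f := fun g : G => (g, x))
      (g := fun gx : G * X => gact gx.1 gx.2)); last exact: gact_continuous.
    by apply: continuous_pair => z; [exact: cvg_id|exact: cvg_cst].
  have gP : \forall k \near g, Num.min 1 (mdist (p (gact g x)) (p (gact k x))) <= e.
    exact: (cx g _ (Dc (gact g x) e e0)).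
  by apply: filterS gP => k kP _ m; exact: le_trans (min_lip _ _ _) kP.
Qed.

Let T := hull_gspace cG Ninv.
Let tau (x : X) : T := Hull (psiP x).

Let tau_continuous : continuous tau.
Proof.
apply: continuous_hullP => x e e0.
have [_ _ _ _ Dc] := pseudometric_cont_psup_compact cG (@gact_continuous G X) DP.
apply: filterS (Dc x e e0) => y /=; apply: le_trans.
apply: hull_dist_le => [|g m]; first exact: psup_ge0.
apply: le_trans (min_lip _ _ _) _.
apply: (psup_ub (f := fun g => Num.min 1 (mdist (p (gact g x)) (p (gact g y))))) => //.
by move=> h _; rewrite ge_min lexx.
Qed.

(** A limit of values of [tau] cannot be bounded away from 0, since [tau x] vanishes at the identity
    and [p x]; so the limit is some [tau x0]. Evaluating at the identity and [p x0] shows that the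
    images under [p] tend to [p x0], and perfectness of [p] applies. *)
Let tau_perfect : perfect_map tau.
Proof.
apply: ultra_perfect_map; first exact: tau_continuous.
move=> F FU u Fu; have FF : ProperFilter F by exact: ultra_proper.
have Fd e : 0 < e -> F [set x | hull_dist u (tau x) <= e].
  by move=> e0; exact: (Fu _ (hull_nearP u e0)).
have [x0 ux0] : exists x0, u = tau x0.
  have [_ _ [[x0 _ ux0]|[c c0 uc]]] := hullP u.
    by exists x0; apply: hull_inj => g m; rewrite -ux0.
  have c2 : 0 < c / 2 by rewrite divr_gt0.
  have [x /= ux] := filter_ex (Fd _ c2).
  have := hull_dist_ub u (tau x) 1%g (p (gact 1%g x)).
  rewrite /= /psi mdistxx; have := uc 1%g (p (gact 1%g x)).
  have -> : Num.min 1 0 = 0 :> R by apply/min_idPr.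
  by rewrite ler_norml => ? /andP[? ?]; lra.
have Fp : p @ F --> p x0.
  move=> V; rewrite -nbhs_ballE => -[e /= e0 eV].
  have e1 : 0 < Num.min e 1 / 2 by rewrite divr_gt0 // lt_min e0 ltr01.
  change (F (p @^-1` V)).
  apply: filterS (Fd _ e1) => x /= ux; apply: eV; rewrite ballEmdist /=.
  have := hull_dist_ub u (tau x) 1%g (p x0); rewrite ux0 /= /psi !gact1 mdistxx.
  have -> : Num.min 1 0 = 0 :> R by apply/min_idPr.
  rewrite sub0r normrN ger0_norm ?le_min ?ler01 ?mdist_ge0 // -ux0 metric_sym.
  move: ux; case: (leP 1 (mdist (p x0) (p x))) => ?; case: (leP e 1) => ?; lra.
have [x _ Fx] := perfect_map_ultra pp FU Fp.
exists x => //; apply: (@hausdorff_cvg_unique _ (tau @ F)) => //.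
  exact: (@metric_hausdorff R (hull N)).
exact: (cvg_comp _ _ Fx (@tau_continuous x)).
Qed.

Let OL := @orbit_lipschitz R G X.
Let k (s : OL) := ol_len s.
Let C := cube_gspace k.

Let lip01 x (s : OL) g : 0 <= s (gact g x) <= 1.
Proof. exact: ol01. Qed.

Let lip_lip x (s : OL) g h :
  `|s (gact (h * g)%g x) - s (gact g x)| <= k s h.
Proof. by rewrite gactM; exact: ol_lip. Qed.

Let gam (x : X) : C := Cube (@lip01 x) (@lip_lip x).

Let gam_continuous : continuous gam.
Proof.
apply: continuous_cubeP => s g.
apply: (continuous_compose (f := fun x : X => gact g x) (g := s)).
  apply: (continuous_compose (f := fun x : X => (g, x))
    (g := fun gx : G * X => gact gx.1 gx.2)); last exact: gact_continuous.
  by apply: continuous_pair => z; [exact: cvg_cst|exact: cvg_id].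
exact: ol_continuous.
Qed.

Let Z := gprod T C.
Let e (x : X) : Z := (tau x, gam x).

Let e_perfect : perfect_map e.
Proof. exact: perfect_map_pair (@cube_hausdorff R G _ k) tau_perfect gam_continuous. Qed.

Let e_inj : injective e.
Proof.
move=> x y exy; have xy : gam x = gam y := congr1 snd exy.
apply: contrapT => nxy.
have [s sxy] := orbit_lipschitz_separates cG hG ppX nxy.
apply: sxy; rewrite -(gact1 x) -(gact1 y).
exact: (congr1 (fun u : C => cube_fun u s 1%g) xy).
Qed.

Let e_equivariant g x : e (gact g x) = gact g (e x).
Proof.
congr (_, _).
  by apply: hull_inj => h m; rewrite /= psi_translate.
apply: cube_inj => s h.
by change (s (gact h (gact g x)) = s (gact (h * g)%g x)); rewrite gactM.
Qed.

Lemma equivariant_embedding_of_perfect : exists (Z : gspace G) (e : gmap X Z),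
  [/\ p_paracompact R Z, equivariant_AE R Z, inhabited Z, closed_map e
    & injective e].
Proof.
have [ce cle _] := e_perfect.
exists Z, (GMap ce e_equivariant); split => //.
- apply: p_paracompact_prod_compact.
  + exact: (@p_paracompact_metric R (hull N)).
  + exact: cube_hausdorff.
  + exact: cube_compact.
- by apply: gprod_AE; [exact: hull_AE|exact: cube_AE].
(* [X] may be empty, so constant functions are used: 1 for the hull, through the clause on functions
   bounded away from 0, and 0 for the cube. *)
constructor; split.
  apply: (@Hull R G M N (fun _ _ => 1)); split.
  - by move=> _ _; rewrite ler01 lexx.
  - by move=> g _ d d0; apply: nearW => h _ m; rewrite subrr normr0 ltW.
  - by right; exists 1 => //; exact: ltr01.
apply: (@Cube R G _ k (fun _ _ => 0)) => [_ _|s _ h].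
  by rewrite lexx ler01.
by rewrite subrr normr0 len_ge0.
Qed.

End embedding.

Lemma equivariant_embedding (R : realType) (G : topologicalGroupType)
    (X : gspace G) : compact [set: G] -> hausdorff_space G ->
  p_paracompact R X -> exists (Z : gspace G) (e : gmap X Z),
  [/\ p_paracompact R Z, equivariant_AE R Z, inhabited Z, closed_map e
    & injective e].
Proof.
move=> cG hG ppX; have /p_paracompactE[_ [M [p pp]]] := ppX.
exact: equivariant_embedding_of_perfect pp.
Qed.

(** * Equivariant homotopies and restriction to a subgroup *)

Section lifts.
Context {X Y : topologicalType} (A : set Y) (f : X -> Y).
Hypothesis fA : forall x, A (f x).

Definition lift_to (x : X) : set_type A := SigSub (mem_set (fA x)).

Lemma lift_toE x : set_val (lift_to x) = f x.
Proof. by []. Qed.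

Lemma lift_to_continuous : continuous f -> continuous lift_to.
Proof. by move=> cf; apply: continuous_to_set_type. Qed.

End lifts.

Section unit_interval.
Context {R : realType}.

Definition unit_interval := set_type (`[0, 1] : set R).

Lemma unit_intervalP (t : unit_interval) : 0 <= set_val t <= 1.
Proof. by have := set_valP t; rewrite /= in_itv. Qed.

Lemma clamp_subproof (r : R) :
  [set` `[0, 1]] (Num.max 0 (Num.min 1 r)).

Proof. by rewrite /= in_itv /= le_max lexx ge_max ler01 ge_min lexx. Qed.

(** Retracts the line onto the interval, so that homotopies can be reparametrized by affine formulas
    without range conditions. *)
Definition clamp : R -> unit_interval := lift_to clamp_subproof.

Lemma clamp_continuous : continuous clamp.
Proof.
apply: lift_to_continuous; apply/continuous_distP => r e e0.
have := (continuous_distP _).1 (fun x : R => @cvg_id _ (nbhs x)) r e e0.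
apply: filterS => s; rewrite !ler_norml => /andP[? ?].
case: (leP 1 r) => ?; case: (leP 1 s) => ?; rewrite !maxEle; do ?case: ifP => ?;
  by apply/andP; split; lra.
Qed.

Lemma clamp0 r : r <= 0 -> set_val (clamp r) = 0.
Proof.
move=> r0; rewrite lift_toE; apply/max_idPl; rewrite ge_min.
by apply/orP; right.
Qed.

Lemma clamp1 r : 1 <= r -> set_val (clamp r) = 1.
Proof. by move=> r1; rewrite lift_toE (min_idPl r1); apply/max_idPr; exact: ler01. Qed.

Lemma unit_interval_compact : compact [set: unit_interval].
Proof.
have -> : [set: unit_interval] = clamp @` `[0, 1].
  apply/seteqP; split => // t _; exists (set_val t).
    by rewrite /= in_itv; exact: unit_intervalP.
  apply: val_inj; rewrite /=; have /andP[t0 t1] := unit_intervalP t.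
  by rewrite (min_idPr t1) (max_idPr t0).
apply: continuous_compact; last exact: segment_compact.
by apply: continuous_subspaceT; exact: clamp_continuous.
Qed.

Lemma unit_interval_hausdorff : hausdorff_space unit_interval.
Proof.
apply: (hausdorff_inj (@Rhausdorff R)); first exact: (@set_val_continuous R).
exact: val_inj.
Qed.

End unit_interval.

Section homotopies.
Context {R : realType} {G : topologicalGroupType}.

Lemma eq_ghomotopic (X Y : gspace G) (f f' g g' : gmap X Y) :
  f =1 f' -> g =1 g' -> ghomotopic R f g -> ghomotopic R f' g'.
Proof.
move=> ff' gg' [F [cF Fi F0 F1]]; exists F; split => //.
- by move=> x t t0; rewrite -ff' (F0 x t t0).
- by move=> x t t1; rewrite -gg' (F1 x t t1).
Qed.

Lemma ghomotopic_sym (X Y : gspace G) (f g : gmap X Y) :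
  ghomotopic R f g -> ghomotopic R g f.
Proof.
move=> [F [cF Fi F0 F1]].
exists (fun xt => F (xt.1, clamp (1 - set_val xt.2))); split.
- apply: (continuous_compose (g := F)) => //.
  apply: continuous_pair; first exact: fst_continuous.
  apply: (continuous_compose (g := clamp)); last exact: clamp_continuous.
  apply: (continuous_compose (f := fun xt : X * unit_interval => set_val xt.2)
    (g := fun r : R => 1 - r)).
    exact: (continuous_compose (@snd_continuous _ _) (@set_val_continuous R _)).
  by move=> r; apply: cvgB; [exact: cvg_cst|exact: cvg_id].
- by move=> h x t; rewrite Fi.
- by move=> x t /= t0; apply: F1; rewrite clamp1 // t0 subr0.
- by move=> x t /= t1; apply: F0; rewrite clamp0 // t1 subrr.
Qed.

Lemma ghomotopic_trans (X Y : gspace G) (g f h : gmap X Y) :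
  ghomotopic R f g -> ghomotopic R g h -> ghomotopic R f h.
Proof.
move=> [F [cF Fi F0 F1]] [F' [cF' Fi' F0' F1']].
pose a (xt : X * unit_interval) := F (xt.1, clamp (2 * set_val xt.2)).
pose b (xt : X * unit_interval) := F' (xt.1, clamp (2 * set_val xt.2 - 1)).
have c2 : continuous (fun xt : X * unit_interval => 2 * set_val xt.2 : R).
  apply: (continuous_compose (f := fun xt : X * unit_interval => set_val xt.2)
    (g := fun r : R => 2 * r)).
    exact: (continuous_compose (@snd_continuous _ _) (@set_val_continuous R _)).
  by move=> r; apply: cvgM; [exact: cvg_cst|exact: cvg_id].
have ca : continuous a.
  apply: (continuous_compose (g := F)) => //.
  apply: continuous_pair; first exact: fst_continuous.
  exact: (continuous_compose c2 clamp_continuous).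
have cb : continuous b.
  apply: (continuous_compose (g := F')) => //.
  apply: continuous_pair; first exact: fst_continuous.
  apply: (continuous_compose (g := clamp)); last exact: clamp_continuous.
  by move=> xt; apply: cvgB; [exact: c2|exact: cvg_cst].
have ab xt : set_val xt.2 = 1 / 2 -> a xt = b xt.
  move=> t2; rewrite /a /b F1 ?F0' //.
    by rewrite clamp0 // t2; lra.
  by rewrite clamp1 // t2; lra.
pose k xt := if set_val xt.2 <= 1 / 2 then a xt else b xt.
exists k; split.
- apply/continuous_subspace_setT.
  pose L := [set xt : X * unit_interval | 2 * set_val xt.2 <= 1 :> R].
  pose U := [set xt : X * unit_interval | 1 <= 2 * set_val xt.2 :> R].
  have -> : [set: X * unit_interval] = L `|` U.
    apply/seteqP; split => // xt _; rewrite /L /U /=.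
    by case: (leP (2 * set_val xt.2) 1) => ?; [left|right; exact: ltW].
  apply: withinU_continuous.
  + exact: (preimage_closedT c2 (@closed_le _ 1)).
  + exact: (preimage_closedT c2 (@closed_ge _ 1)).
  + apply: (@subspace_eq_continuous _ _ _ a); last exact: continuous_subspaceT.
    move=> xt; rewrite inE => xtL; rewrite /from_subspace /k.
    by case: leP => // xt2; exfalso; move: xtL xt2; rewrite /L /=; lra.
  + apply: (@subspace_eq_continuous _ _ _ b); last exact: continuous_subspaceT.
    move=> xt; rewrite inE => xtU; rewrite /from_subspace /k.
    by case: leP => // xt2; rewrite ab //; move: xtU; rewrite /U /=; lra.
- by move=> g' x t; rewrite /k /a /b /= Fi Fi'; case: ifP.
- move=> x t t0; rewrite /k /= t0 divr_ge0 // /a /=; apply: F0.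
  by rewrite clamp0 // t0 mulr0.
- move=> x t t1; rewrite /k /= t1; case: ifP => [h2|_]; first by exfalso; lra.
  by rewrite /b /=; apply: F1'; rewrite clamp1 // t1; lra.
Qed.

Lemma ghomotopic_compl (X Y Z : gspace G) (f g : gmap X Y) (k : gmap Y Z) :
  ghomotopic R f g -> ghomotopic R (gcomp k f) (gcomp k g).
Proof.
move=> [F [cF Fi F0 F1]]; exists (k \o F); split.
- by apply: continuous_compose => //; exact: gmap_continuous.
- by move=> g' x t; rewrite /= Fi gmap_equivariant.
- by move=> x t t0; rewrite /= F0.
- by move=> x t t1; rewrite /= F1.
Qed.

Lemma ghomotopic_compr (X Y Z : gspace G) (f g : gmap Y Z) (k : gmap X Y) :
  ghomotopic R f g -> ghomotopic R (gcomp f k) (gcomp g k).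
Proof.
move=> [F [cF Fi F0 F1]]; exists (fun xt => F (k xt.1, xt.2)); split.
- apply: (continuous_compose (g := F)) => //.
  apply: continuous_pair; last exact: snd_continuous.
  exact: (continuous_compose (@fst_continuous _ _) (@gmap_continuous _ _ _ k)).
- by move=> g' x t; rewrite /= gmap_equivariant Fi.
- by move=> x t t0; rewrite /= F0.
- by move=> x t t1; rewrite /= F1.
Qed.

End homotopies.

Section restrict_maps.
Context {R : realType} {G : topologicalGroupType} (H : closed_subgroup G).

Definition subgroup_hom : continuous_hom (subgroup_type H) G :=
  @ContinuousHom (subgroup_type H) G (@subgroup_val G H)
    (@subgroup_val_continuous G H) (fun _ _ => erefl).

Lemma subgroup_hausdorff : hausdorff_space G -> hausdorff_space (subgroup_type H).
Proof.
move=> hG; apply: (hausdorff_inj hG) (@subgroup_val_inj G H).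
exact: subgroup_val_continuous.
Qed.

Lemma subgroup_compact : compact [set: G] -> compact [set: subgroup_type H].
Proof.
move=> cG; rewrite compact_ultra => F FU _.
have FF : ProperFilter F by exact: ultra_proper.
have := cG; rewrite compact_ultra.
move=> /(_ _ (ultra_fmap (@subgroup_val G H) FU) filterT)[g [_ Fg]].
have Hg : csg_set H g.
  apply: (@csg_closed G H) => B nB; have FB : F (@subgroup_val G H @^-1` B) := Fg _ nB.
  by have [h Bh] := filter_ex FB; exists (subgroup_val h); split => //; exact: subgroup_valP.
pose h : subgroup_type H := SigSub (mem_set Hg).
exists h; split => // B [_ [[W oW <-] /= Wh] WB].
by apply: (filterS WB); apply: (Fg W); exact: open_nbhs_nbhs.
Qed.

Lemma gmap_restrict_equivariant (X Y : gspace G) (f : gmap X Y)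
  (h : subgroup_type H) (x : gspace_restrict H X) :
  f (gact h x) = gact h (f x : gspace_restrict H Y) :> gspace_restrict H Y.
Proof. exact: (@gmap_equivariant G X Y f (subgroup_val h) x). Qed.

Definition gmap_restrict (X Y : gspace G) (f : gmap X Y) :
    gmap (gspace_restrict H X) (gspace_restrict H Y) :=
  @GMap _ (gspace_restrict H X) (gspace_restrict H Y) f
    (@gmap_continuous _ _ _ f) (gmap_restrict_equivariant f).

Lemma ghomotopic_restrict (X Y : gspace G) (f g : gmap X Y) :
  ghomotopic R f g -> ghomotopic R (gmap_restrict f) (gmap_restrict g).
Proof.
move=> [F [cF Fi F0 F1]]; exists F; split => //.
by move=> h x t; exact: (Fi (subgroup_val h) x t).
Qed.

End restrict_maps.

(** * Equivariant neighborhood retracts *)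

Definition id_hom (G : topologicalGroupType) : continuous_hom G G :=
  @ContinuousHom G G idfun (fun x => cvg_id) (fun _ _ => erefl).

Section closed_embeddings.
Context {X Y Z : topologicalType} (j : X -> Y) (f : X -> Z) (z0 : Z).
Hypotheses (clj : closed_map j) (injj : injective j).

Lemma near_closed_embedding x (B : set X) : nbhs x B ->
  \forall y \near j x, forall x', j x' = y -> B x'.
Proof.
move=> nB; have clC : closed (j @` (~` interior B)).
  by apply: clj; apply: open_closedC; exact: open_interior.
have nC : nbhs (j x) (~` (j @` (~` interior B))).
  apply: open_nbhs_nbhs; split; first exact: closed_openC.
  by move=> [x' nx' /injj xx']; apply: nx'; rewrite xx'; exact: nB.
apply: filterS nC => y ny x' xy; apply: contrapT => nBx'; apply: ny.
by exists x' => // /nbhs_singleton.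
Qed.

(** Presents a map on the source of a closed embedding as a total map on its target. The junk value
    [z0] off the range is the reason for carrying a point of the extensor along. *)
Definition partial_inverse (y : Y) : Z :=
  if pselect (exists x, j x = y) is left ex then f (projT1 (cid ex)) else z0.

Lemma partial_inverseE x : partial_inverse (j x) = f x.
Proof.
rewrite /partial_inverse; case: pselect => [ex|[]]; last by exists x.
by congr f; apply: injj; exact: (projT2 (cid ex)).
Qed.

Lemma partial_inverse_continuous : continuous f ->
  {within range j, continuous partial_inverse}.
Proof.
move=> cf; apply/subspace_continuousP => _ [x _ <-] B nB0.
have nB : nbhs (f x) B by rewrite -(partial_inverseE x).
have nx := near_closed_embedding (cf x B nB).
change (\forall y \near j x, range j y -> B (partial_inverse y)).
apply: filterS nx => y yB [x' _ xy].
by rewrite -xy partial_inverseE; exact: yB.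
Qed.

End closed_embeddings.

Lemma closed_range (X Y : topologicalType) (j : X -> Y) :
  closed_map j -> closed (range j).
Proof. by move=> clj; apply: clj; exact: closedT. Qed.

Section invariant_sets.
Context {G : topologicalGroupType} (E : gspace G).

Lemma gact_continuousr g : continuous (gact g : E -> E).
Proof.
apply: (continuous_compose (f := fun x : E => (g, x))
  (g := fun gx : G * E => gact gx.1 gx.2)); last exact: gact_continuous.
by apply: continuous_pair => x; [exact: cvg_cst|exact: cvg_id].
Qed.

Lemma gactK g (x : E) : gact (g^-1)%g (gact g x) = x.
Proof. by rewrite -gactM mulVg gact1. Qed.

Lemma interior_invariant (U : set E) : (forall g x, U x -> U (gact g x)) ->
  forall g x, interior U x -> interior U (gact g x).
Proof.
move=> Uinv g x Ux.
have nU : \forall y \near gact g x, U (gact (g^-1)%g y).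
  by apply: (@gact_continuousr (g^-1)%g (gact g x) U); rewrite gactK.
by apply: filterS nU => y /= /(Uinv g); rewrite -gactM mulgV gact1.
Qed.

Context (A : set E) (Ainv : forall g x, A x -> A (gact g x)).

Let sub_act (g : G) (u : set_type A) : set_type A :=
  SigSub (mem_set (Ainv g (set_valP u))).

Let sub_act1 u : sub_act 1%g u = u.
Proof. by apply: val_inj; exact: gact1. Qed.

Let sub_actM g h u : sub_act (g * h)%g u = sub_act g (sub_act h u).
Proof. by apply: val_inj; exact: gactM. Qed.

Let sub_act_continuous :
  continuous (fun gu : G * set_type A => sub_act gu.1 gu.2).
Proof.
apply: continuous_to_set_type.
apply: (continuous_compose (f := fun gu : G * set_type A => (gu.1, set_val gu.2))
  (g := fun gx : G * E => gact gx.1 gx.2)); last exact: gact_continuous.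
apply: continuous_pair; first exact: fst_continuous.
exact: (continuous_compose (@snd_continuous _ _) (@set_val_continuous _ _)).
Qed.

Definition gsub : gspace G := GSpace sub_act1 sub_actM sub_act_continuous.

Lemma gsub_valE g (u : gsub) : set_val (gact g u : set_type A) = gact g (set_val u).
Proof. by []. Qed.

End invariant_sets.

Lemma open_set_val (X : topologicalType) (A : set X) (O : set (set_type A)) :
  open A -> open O -> open (set_val @` O).
Proof.
move=> oA [W oW <-].
have -> : (set_val : set_type A -> X) @` (set_val @^-1` W) = A `&` W.
  apply/seteqP; split => [_ [u Wu <-]|x [Ax Wx]].
    by split => //; exact: set_valP.
  by exists (SigSub (mem_set Ax)).
exact: openI.
Qed.

Lemma equivariant_AE_extend (R : realType) (H G : topologicalGroupType)
    (i : continuous_hom H G) (Z : gspace G) (z0 : Z) (E0 E : gspace H)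
    (j : gmap E0 E) (f : E0 -> Z) :
  equivariant_AE R Z -> compact [set: H] -> p_paracompact R E ->
  closed_map j -> injective j -> continuous f ->
  (forall h x, f (gact h x) = gact (i h) (f x)) ->
  exists F : E -> Z, [/\ continuous F,
    forall h x, F (gact h x) = gact (i h) (F x) & forall x, F (j x) = f x].
Proof.
move=> aZ cH ppE clj jI cf fi.
have [||F [cF Fi Ff]] := aZ H i E (range j) (partial_inverse j f z0) cH ppE
    (closed_range clj) _ (partial_inverse_continuous clj jI cf).
- by move=> h _ [x _ <-]; exists (gact h x) => //; exact: gmap_equivariant.
- by move=> h _ [x _ <-]; rewrite -gmap_equivariant !partial_inverseE.
exists F; split => // x; rewrite Ff ?partial_inverseE //; by exists x.
Qed.

(** Since [K] may be empty, a partial map to [K] is presented as a total map to the inhabited [Z]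
    whose values over [A] lie in the image of [e]. It is extended to [Z] and then retracted where
    its values are close to [K]. *)
Lemma GANR_neighborhood_extension (R : realType) (G : topologicalGroupType)
    (K : gspace G) : compact [set: G] -> hausdorff_space G -> GANR R K ->
  exists (Z : gspace G) (e : gmap K Z),
  [/\ inhabited Z, injective e
    & forall (E : gspace G) (A : set E) (f : E -> Z), p_paracompact R E ->
      closed A -> (forall g x, A x -> A (gact g x)) ->
      {within A, continuous f} ->
      (forall g x, A x -> f (gact g x) = gact g (f x)) ->
      (forall x, A x -> exists y, e y = f x) ->
      exists (U : set E) (F : set_type U -> K),
      [/\ open U /\ A `<=` U, forall g x, U x -> U (gact g x), continuous F,
          forall g (u v : set_type U),
            set_val v = gact g (set_val u) -> F v = gact g (F u)
        & forall u : set_type U, A (set_val u) -> e (F u) = f (set_val u)]].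
Proof.
move=> cG hG [ppK K_retract].
have [Z [e [ppZ aZ Z0 cle eI]]] := equivariant_embedding cG hG ppK.
exists Z, e; split => // E A f ppE clA Ainv cf fi fe.
have [V [eV Vinv [r [cr ri re]]]] := K_retract Z e ppZ eI cle.
have [F0 [cF0 F0i F0f]] := aZ G (id_hom G) E A f cG ppE clA Ainv cf fi.
pose U := F0 @^-1` interior V.
have VU (u : set_type U) : V (F0 (set_val u)).
  by apply: interior_subset; exact: (set_valP u).
pose l := lift_to VU.
have cl : continuous l.
  apply: lift_to_continuous.
  exact: (continuous_compose (@set_val_continuous _ _) cF0).
exists U, (r \o l); split.
- split; first by apply: open_comp => //; exact: open_interior.
  move=> x Ax; rewrite /U /= F0f //; apply: eV.
  by have [y <-] := fe x Ax; exists y.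
- by move=> g x Ux; rewrite /U /= F0i; exact: interior_invariant.
- exact: continuous_compose cl cr.
- by move=> g u v uv; apply: ri; rewrite !lift_toE uv F0i.
- move=> u Au; have [y ey] := fe _ Au.
  rewrite -ey; congr (e _); apply: re.
  by rewrite lift_toE F0f.
Qed.

(** The embedding of [Y] into its [G]-extensor [Z] extends over [Q] as an [H]-map, because [Z] is an
    extensor for [H] as well. The retraction onto [Y] that comes from the [G]-structure is then
    pulled back. *)
Lemma GANR_restrict (R : realType) (G : topologicalGroupType)
    (H : closed_subgroup G) (Y : gspace G) : compact [set: G] ->
  hausdorff_space G -> GANR R Y -> GANR R (gspace_restrict H Y).
Proof.
move=> cG hG [ppY Y_retract]; split => // Q j ppQ jI clj.
have [Z [e [ppZ aZ [z0] cle eI]]] := equivariant_embedding cG hG ppY.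
have [V [eV Vinv [r [cr ri re]]]] := Y_retract Z e ppZ eI cle.
have [F [cF Fi Fj]] := equivariant_AE_extend (i := subgroup_hom H) z0 aZ
  (subgroup_compact (H := H) cG) ppQ clj jI (@gmap_continuous _ _ _ e)
  (fun h x => gmap_equivariant e (subgroup_val h) x).
have VF (u : set_type (F @^-1` V)) : V (F (set_val u)) by exact: (set_valP u).
exists (F @^-1` V); split.
- move=> _ [y _ <-].
  have ny : nbhs (j y) (F @^-1` interior V).
    apply: open_nbhs_nbhs; split; first by apply: open_comp => //; exact: open_interior.
    by rewrite /= Fj; apply: eV; exists y.
  by apply: (filterS _ ny) => q; exact: interior_subset.
- by move=> h q Vq; rewrite /= Fi; exact: Vinv.
exists (r \o lift_to VF); split.
- apply: continuous_compose cr; apply: lift_to_continuous.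
  exact: (continuous_compose (@set_val_continuous _ _) cF).
- by move=> h u v uv; apply: ri; rewrite !lift_toE uv Fi.
- by move=> y u uy; apply: re; rewrite lift_toE uy Fj.
Qed.

(** An open subset may fail to be paracompact. A cozero set is closed in [E x R] through [w] paired
    with the inverse of [1 - f w]: at a limit the product of the two quantities is still 1, so [f]
    does not reach 1. *)
Lemma p_paracompact_cozero (R : realType) (E : topologicalType) (f : E -> R) :
  p_paracompact R E -> continuous f -> (forall x, f x <= 1) ->
  p_paracompact R (set_type [set x | f x < 1]).
Proof.
move=> ppE cf f1; pose W := set_type [set x | f x < 1].
have ppER : p_paracompact R (E * R^o)%type.
  by apply: p_paracompact_prod => //; exact: (@p_paracompact_metric R R^o).
pose d (w : W) : R := 1 - f (set_val w).
have d0 w : 0 < d w by have := set_valP w; rewrite /= /d; lra.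
have c1 : continuous (fun r : R => 1 - r).
  by move=> r; apply: cvgB; [exact: cvg_cst|exact: cvg_id].
have cd : continuous d.
  apply: (continuous_compose (f := fun w : W => f (set_val w)) _ c1).
  exact: (continuous_compose (@set_val_continuous _ _) cf).
pose a (w : W) : E * R^o := (set_val w, (d w)^-1).
apply: (p_paracompact_perfect (f := a)) (ppER).
  apply: (hausdorff_inj (f := set_val)); first by case: ppE.
    exact: set_val_continuous.
  exact: val_inj.
apply: ultra_perfect_map.
  apply: continuous_pair; first exact: set_val_continuous.
  by move=> w; exact: (cvgV (lt0r_neq0 (d0 w)) (cd w)).
move=> F FU [y t] Fa; have FF : ProperFilter F by exact: ultra_proper.
have /cvg_prodP [Fy Ft] := Fa.
have Fd : d @ F --> 1 - f y.
  have Ff := cvg_comp (set_val : W -> E) f Fy (cf y).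
  exact: (cvg_comp (f \o set_val) _ Ff (c1 (f y))).
have dt : (1 - f y) * t = 1.
  apply: (@hausdorff_cvg_unique R ((fun w => d w * (d w)^-1) @ F)).
  - exact: Rhausdorff.
  - exact: cvgM Fd Ft.
  - have -> : (fun w => d w * (d w)^-1) = cst 1.
      by apply/funext => w; rewrite mulfV // gt_eqF.
    exact: cvg_cst.
have fy : f y < 1.
  rewrite lt_neqAle f1 andbT; apply/eqP => fy1.
  by move: dt; rewrite fy1 subrr mul0r => /esym/eqP; rewrite oner_eq0.
pose x : W := SigSub (mem_set (fy : [set x | f x < 1] y)).
have Fx : F --> x.
  move=> B [_ [[ O oO <-] /= Ox] OB].
  by apply: (filterS OB); apply: (Fy O); exact: open_nbhs_nbhs.
exists x => //; congr (_, _).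
apply: (@mulfI _ (1 - f y)); first by rewrite gt_eqF // subr_gt0.
by rewrite dt mulfV // gt_eqF // subr_gt0.
Qed.

Section cozero_neighborhoods.
Context {R : realType} {G : topologicalGroupType}.
Hypotheses (cG : compact [set: G]) (hG : hausdorff_space G).
Context (Z Y : gspace G).
Hypotheses (ppZ : p_paracompact R Z) (aZ : equivariant_AE R Z) (z0 : Z).
Hypothesis Y_ANR : GANR R Y.

(** The coordinates extend separately: the one in [Z] over all of [Q], the one in [Y] over a
    neighborhood. The condition [f < 1] then cuts out an open set on which the pair lands in the
    cozero set. *)
Lemma GANR_cozero (f : gprod Z Y -> R)
    (f_inv : forall g x, f x < 1 -> f (gact g x) < 1) :
  continuous f -> (forall x, f x <= 1) -> GANR R (gsub (A := [set x | f x < 1]) f_inv).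
Proof.
move=> cf f1; set W := gsub _.
have [ppY _] := Y_ANR.
split; first by apply: p_paracompact_cozero => //; exact: p_paracompact_prod.
move=> Q i ppQ iI cli.
have [F1 [cF1 F1i F1E]] := equivariant_AE_extend (i := id_hom G)
  (f := fun w : W => (set_val w).1) z0 aZ cG ppQ cli iI
  (continuous_compose (@set_val_continuous _ _) (@fst_continuous _ _))
  (fun g w => erefl).
have [ZY [e [[zY] eI eE]]] := GANR_neighborhood_extension cG hG Y_ANR.
pose s (w : W) := e (set_val w).2.
have cs : continuous s.
  apply: (continuous_compose (f := fun w : W => (set_val w).2) (g := e)).
    exact: (continuous_compose (@set_val_continuous _ _) (@snd_continuous _ _)).
  exact: gmap_continuous.
have [|||U [F2 [[oU iU] Uinv cF2 F2i F2E]]] := eE Q (range i)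
    (partial_inverse i s zY) ppQ (closed_range cli) _
    (partial_inverse_continuous cli iI cs).
- by move=> g _ [w _ <-]; exists (gact g w) => //; exact: gmap_equivariant.
- move=> g _ [w _ <-]; rewrite -gmap_equivariant !partial_inverseE //.
  by rewrite /s gsub_valE /= gmap_equivariant.
- by move=> _ [w _ <-]; rewrite partial_inverseE //; exists (set_val w).2.
pose m (u : set_type U) : gprod Z Y := (F1 (set_val u), F2 u).
have cm : continuous m.
  apply: continuous_pair => //.
  exact: (continuous_compose (@set_val_continuous _ _) cF1).
pose O : set (set_type U) := [set u | f (m u) < 1].
have oO : open O.
  have cfm : continuous (fun u => f (m u)) := continuous_compose cm cf.
  exact: (open_comp (fun u _ => cfm u) (@open_lt _ 1)).
pose V := set_val @` O.
have mi g u v : set_val v = gact g (set_val u) -> m v = gact g (m u).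
  by move=> uv; rewrite /m (F2i g u v uv) uv F1i.
have mE w u : set_val u = i w -> m u = set_val w.
  move=> uw; rewrite /m uw F1E [RHS]surjective_pairing; congr (_, _).
  by apply: eI; rewrite F2E uw ?partial_inverseE //; exists w.
exists V; split.
- move=> _ [w _ <-]; apply: open_nbhs_nbhs; split; first exact: open_set_val.
  have Uw : U (i w) by apply: iU; exists w.
  pose u : set_type U := SigSub (mem_set Uw).
  by exists u => //; rewrite /O /= (mE w u) //; exact: (set_valP w).
- move=> g _ [u Ou <-].
  have Ugu : U (gact g (set_val u)) by apply: Uinv; exact: set_valP.
  exists (SigSub (mem_set Ugu)) => //.
  by rewrite /O /= (mi g u) //; exact: (f_inv g (m u) Ou).
have VU (v : set_type V) : U (set_val v).
  have [u _ uv] := set_valP v.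
  exact: (eq_ind _ U (set_valP u) _ uv).
have VO (v : set_type V) : f (m (lift_to VU v)) < 1.
  have [u Ou uv] := set_valP v.
  by have -> : lift_to VU v = u by exact: val_inj.
have cl : continuous (lift_to VU).
  by apply: lift_to_continuous; exact: set_val_continuous.
exists (lift_to (A := [set x | f x < 1]) VO); split.
- by apply: lift_to_continuous; exact: continuous_compose cl cm.
- by move=> g u v uv; apply: val_inj; exact: mi.
- by move=> w v vw; apply: val_inj; exact: mE.
Qed.

(** [U] need not be [G]-invariant. The supremum over [G] of a Urysohn function that is 0 on the
    image of [X] and 1 off [U] still vanishes on that invariant image, and its sublevel set below 1
    is an invariant cozero neighborhood inside [U]. *)
Lemma GANR_neighborhood (X : gspace G) (p : gmap X Y) (e : gmap X Z)
    (U : set (gprod Z Y)) : closed_map e -> injective e -> open U ->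
  (forall x, U (e x, p x)) ->
  exists (W : gspace G) (j : gmap X W) (q : gmap W (gprod Z Y)),
  [/\ GANR R W, forall x, q (j x) = (e x, p x) & forall w, U (q w)].
Proof.
move=> cle eI oU pU; have [ppY _] := Y_ANR; have [hY _] := ppY.
have ppE : p_paracompact R (gprod Z Y) by exact: p_paracompact_prod.
pose a x : gprod Z Y := (e x, p x).
have pa : perfect_map a.
  apply: perfect_map_pair => //; last exact: gmap_continuous.
  apply: perfect_map_closed_embedding => //; exact: gmap_continuous.
have [ca cla _] := pa.
have ai g x : a (gact g x) = gact g (a x).
  by rewrite /a !gmap_equivariant.
have [|f0 [cf0 f001 f0a f0U]] := normal_urysohn R (p_paracompact_normal ppE)
    (closed_range cla) (open_closedC oU).
  by apply/seteqP; split => // _ [[x _ <-]]; apply; exact: pU.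
pose f z := psup setT (fun g => f0 (gact g z)).
have f0le1 g z : f0 (gact g z) <= 1 by case/andP: (f001 (gact g z)).
have f1 z : f z <= 1 by apply: psup_le.
have fi g z : f (gact g z) <= f z.
  apply: psup_le => [|h _]; first exact: psup_ge0.
  rewrite -gactM.
  by apply: (psup_ub (f := fun g => f0 (gact g z))).
have cf : continuous f.
  apply/continuous_distP => z d d0.
  have [_ _ _ _ Dc] := pseudometric_cont_psup_compact cG
    (@gact_continuous G (gprod Z Y)) (pseudometric_cont_fun cf0 f001).
  apply: filterS (Dc z d d0) => w /=; apply: le_trans.
  apply: psup_dist => // [|g _]; first exact: psup_ge0.
  apply: (psup_ub (f := fun g => `|f0 (gact g z) - f0 (gact g w)|)) => // h _.
  by have [/(_ (gact h z) (gact h w))/andP[]] := pseudometric_cont_fun cf0 f001.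
have f_inv g z : f z < 1 -> f (gact g z) < 1 by exact: le_lt_trans (fi g z).
have fa x : f (a x) < 1.
  apply: le_lt_trans (ltr01); apply: psup_le => // g _.
  by rewrite f0a //; exists (gact g x).
pose W := gsub (A := [set z | f z < 1]) f_inv.
have cj : continuous (lift_to (A := [set z | f z < 1]) fa : X -> W).
  exact: lift_to_continuous.
have ji g x : (lift_to (A := [set z | f z < 1]) fa (gact g x) : W) =
    gact g (lift_to (A := [set z | f z < 1]) fa x : W).
  by apply: val_inj; rewrite /= ai.
have cq : continuous (set_val : W -> gprod Z Y) by exact: set_val_continuous.
exists W, (GMap cj ji), (@GMap G W (gprod Z Y) _ cq (fun g w => erefl)).
split => //; first exact: GANR_cozero.
have fU z : ~ U z -> 1 <= f z.
  move=> /f0U <-; rewrite -{1}[z](@gact1 G (gprod Z Y)).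
  by apply: (psup_ub (f := fun g => f0 (gact g z))).
move=> w; apply: contrapT => /fU; rewrite leNgt => /negP; apply.
exact: (set_valP w).
Qed.

End cozero_neighborhoods.

(** * The restricted system *)

Section pairs.
Context {G : topologicalGroupType} {X Y Z : gspace G}.

Definition gpair (e : gmap X Z) (p : gmap X Y) : gmap X (gprod Z Y) :=
  @GMap G X (gprod Z Y) (fun x => (e x, p x))
    (continuous_pair (@gmap_continuous _ _ _ e) (@gmap_continuous _ _ _ p))
    (fun g x => f_equal2 pair (gmap_equivariant e g x) (gmap_equivariant p g x)).

Lemma gpair_closed_map (e : gmap X Z) (p : gmap X Y) : hausdorff_space Y ->
  closed_map e -> injective e -> closed_map (gpair e p).
Proof.
move=> hY cle eI; have [] : perfect_map (gpair e p).
  apply: perfect_map_pair => //; last exact: gmap_continuous.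
  by apply: perfect_map_closed_embedding => //; exact: gmap_continuous.
by [].
Qed.

Lemma gpair_inj (e : gmap X Z) (p : gmap X Y) : injective e ->
  injective (gpair e p).
Proof. by move=> eI x y /(congr1 fst)/eI. Qed.

Definition gsnd : gmap (gprod Z Y) Y :=
  @GMap G (gprod Z Y) Y snd (@snd_continuous _ _) (fun _ _ => erefl).

End pairs.

Definition gtrivial (G : topologicalGroupType) (T : topologicalType) : gspace G :=
  @GSpace G T (fun _ x => x) (fun _ => erefl) (fun _ _ _ => erefl)
    (@snd_continuous G T).

Section associated_restrict.
Context {R : realType} {G : topologicalGroupType} (H : closed_subgroup G).
Hypotheses (cG : compact [set: G]) (hG : hausdorff_space G).
Context (X : gspace G) (S : gsystem R G) (p : forall a, gmap X (S a)).
Hypothesis ppX : p_paracompact R X.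
Hypothesis S_ANR : forall a, GANR R (S a).
Hypothesis p_factor : forall W : gspace G, GANR R W -> forall h : gmap X W,
  exists a (f : gmap (S a) W), ghomotopic R h (gcomp f (p a)).

Let cH := subgroup_compact (H := H) cG.
Let hH := subgroup_hausdorff (H := H) hG.

Section neighborhoods.
Context (a : gs_idx S) (Z : gspace G) (e : gmap X Z).
Hypotheses (ppZ : p_paracompact R Z) (aZ : equivariant_AE R Z) (z0 : Z).
Hypotheses (cle : closed_map e) (eI : injective e).

Let E := gprod Z (S a).
Let pe : gmap X E := gpair e (p a).

Let hSa : hausdorff_space (S a).
Proof. by case: (S_ANR a) => -[]. Qed.

Let ppE : p_paracompact R E.
Proof. by apply: p_paracompact_prod => //; case: (S_ANR a). Qed.

Let clpe : closed_map pe. Proof. exact: gpair_closed_map. Qed.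

Let peI : injective pe. Proof. exact: gpair_inj. Qed.

(** Up to the inclusion [j] into [W], the [H]-map [h] is an [H]-map on a [G]-ANR, and [j] itself is
    a [G]-map to which the factorization property of [S] applies. *)
Lemma restrict_factor_neighborhood (K : gspace (subgroup_type H))
    (h : gmap (gspace_restrict H X) K) : GANR R K ->
  exists b (f : gmap (gspace_restrict H (S b)) K),
    ghomotopic R h (gcomp f (gmap_restrict H (p b))).
Proof.
move=> K_ANR.
have [ZK [eK [[zK] eKI eKE]]] := GANR_neighborhood_extension cH hH K_ANR.
pose s := partial_inverse pe (eK \o h) zK.
have [||||U [F [[oU peU] Uinv cF Fi FE]]] :=
  eKE (gspace_restrict H E) (range pe) s ppE (closed_range clpe).
- by move=> g _ [x _ <-]; exists (gact (subgroup_val g) x) => //; rewrite gmap_equivariant.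
- apply: partial_inverse_continuous => //.
  exact: (continuous_compose (@gmap_continuous _ _ _ h) (@gmap_continuous _ _ _ eK)).
- move=> g _ [x _ <-].
  have -> : gact g (pe x : gspace_restrict H E) = pe (gact (subgroup_val g) x).
    by rewrite (gmap_equivariant pe).
  rewrite /s !partial_inverseE //=.
  rewrite -(gmap_equivariant eK) -(gmap_equivariant h).
  by [].
- by move=> _ [x _ <-]; rewrite /s partial_inverseE //; exists (h x).
have [|W [j [q [W_ANR qj Uq]]]] :=
  GANR_neighborhood cG hG ppZ aZ z0 (S_ANR a) (p := p a) cle eI oU.
  by move=> x; apply: peU; exists x.
have cl : continuous (F \o lift_to Uq).
  apply: continuous_compose cF; apply: lift_to_continuous.
  exact: gmap_continuous.
have li (g : subgroup_type H) (w : gspace_restrict H W) :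
    (F \o lift_to Uq) (gact g w) = gact g ((F \o lift_to Uq) w).
  by apply: Fi; rewrite !lift_toE; exact: (gmap_equivariant q (subgroup_val g) w).
pose k : gmap (gspace_restrict H W) K := @GMap _ (gspace_restrict H W) K _ cl li.
have [b [u ju]] := p_factor W_ANR j.
exists b, (gcomp k (gmap_restrict H u)).
apply: eq_ghomotopic (ghomotopic_compl k (ghomotopic_restrict H ju)).
  move=> x; apply: eKI.
  change (eK (F (lift_to Uq (j x))) = eK (h x)).
  rewrite FE lift_toE qj; last by exists x.
  by rewrite /s (partial_inverseE _ _ peI x).
by move=> x.
Qed.

(** A homotopy extension problem on [E x I]: the two ends carry [f] and [f'] composed with the
    projection to [S a], and [X x I] carries the given homotopy. The extension lives near the union
    of these sets, hence on [W x I] for a small neighborhood [W] of [X]. *)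
Lemma restrict_homotopy_neighborhood (K : gspace (subgroup_type H))
    (f f' : gmap (gspace_restrict H (S a)) K) : GANR R K ->
  ghomotopic R (gcomp f (gmap_restrict H (p a)))
    (gcomp f' (gmap_restrict H (p a))) ->
  exists (W : gspace G) (j : gmap X W) (v : gmap W (S a)),
  [/\ GANR R W, forall x, v (j x) = p a x
    & ghomotopic R (gcomp f (gmap_restrict H v)) (gcomp f' (gmap_restrict H v))].
Proof.
move=> K_ANR [Th [cTh Thi Th0 Th1]].
have [ZK [eK [[zK] eKI eKE]]] := GANR_neighborhood_extension cH hH K_ANR.
pose J := gtrivial (subgroup_type H) (@unit_interval R).
pose EJ := gprod (gspace_restrict H E) J.
have ppEJ : p_paracompact R EJ.
  by apply: p_paracompact_prod_compact => //;
    [exact: unit_interval_hausdorff|exact: unit_interval_compact].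
pose A0 : set EJ := [set w | set_val w.2 = 0].
pose A1 : set EJ := [set w | set_val w.2 = 1].
pose i (xt : X * @unit_interval R) : EJ := (pe xt.1, xt.2).
have pi : perfect_map i.
  apply: (perfect_map_prod (f := pe) (f' := idfun)).
    by apply: perfect_map_closed_embedding => //; exact: gmap_continuous.
  apply: perfect_map_closed_embedding => // [t|B]; first exact: cvg_id.
  by rewrite image_id.
have [ci cli _] := pi.
have iI : injective i.
  move=> [x t] [y t'] xy.
  have xE : x = y := peI (congr1 fst xy).
  have tE : t = t' := congr1 snd xy.
  by rewrite xE tE.
have ct : continuous (fun w : EJ => set_val w.2 : R).
  exact: (continuous_compose (@snd_continuous _ _) (@set_val_continuous R _)).
have cl0 : closed A0.
  exact: (preimage_closedT ct (@closed_eq R 0)).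
have cl1 : closed A1 by exact: (preimage_closedT ct (@closed_eq R 1)).
have ii g x t : i (gact (subgroup_val g) x, t) = gact (g : subgroup_type H) (i (x, t)).
  by congr (_, _); exact: (gmap_equivariant pe (subgroup_val g) x).
pose s2 := partial_inverse i (eK \o Th) zK.
(* The three prescriptions agree on overlaps by [Th0] and [Th1], so the order of the tests is
   harmless. *)
pose s (w : EJ) := if set_val w.2 == 0 :> R then eK (f w.1.2) else
  if set_val w.2 == 1 :> R then eK (f' w.1.2) else s2 w.
have s0E w : A0 w -> s w = eK (f w.1.2) by rewrite /A0 /s /= => ->; rewrite eqxx.
have s1E w : A1 w -> s w = eK (f' w.1.2).
  by rewrite /A1 /s /= => ->; rewrite eqxx oner_eq0.
have s2E xt : s (i xt) = eK (Th xt).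
  case: xt => x t; rewrite /s /=; case: eqP => [t0|_]; first by rewrite Th0.
  case: eqP => [t1|_]; first by rewrite Th1.
  exact: partial_inverseE.
pose A := A0 `|` A1 `|` range i.
have cs k (k' : gmap (gspace_restrict H (S a)) K) :
    (forall w, k w -> s w = eK (k' w.1.2)) -> {within k, continuous s}.
  move=> kk'; apply: (@subspace_eq_continuous _ k _ (fun w => eK (k' w.1.2))).
    by move=> w; rewrite inE => kw; rewrite /from_subspace kk'.
  apply: continuous_subspaceT.
  apply: (continuous_compose (f := fun w : EJ => k' w.1.2) (g := eK)).
    apply: (continuous_compose (f := fun w : EJ => w.1.2) (g := k')).
      exact: (continuous_compose (@fst_continuous _ _) (@snd_continuous _ _)).
    exact: (@gmap_continuous _ _ _ k').
  exact: (@gmap_continuous _ _ _ eK).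
have [|||||U [F [[oU AU] Uinv cF Fi FE]]] := eKE EJ A s ppEJ.
- by apply: closedU; [exact: closedU|exact: closed_range].
- move=> g w [[w0|w1]|[[x t] _ <-]]; [by left; left|by left; right|right].
  by exists (gact (subgroup_val g) x, t) => //; exact: ii.
- apply: withinU_continuous; [exact: closedU|exact: closed_range| |].
    by apply: withinU_continuous => //; [exact: cs s0E|exact: cs s1E].
  apply: (@subspace_eq_continuous _ (range i) _ s2).
    move=> w; rewrite inE => -[xt _ <-].
    by rewrite /from_subspace s2E /s2 partial_inverseE.
  apply: partial_inverse_continuous => //.
  exact: (continuous_compose cTh (@gmap_continuous _ _ _ eK)).
- move=> g w [[w0|w1]|[[x t] _ <-]].
  + by rewrite !s0E // -(gmap_equivariant eK) -(gmap_equivariant f).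
  + by rewrite !s1E // -(gmap_equivariant eK) -(gmap_equivariant f').
  + by rewrite -ii !s2E -(gmap_equivariant eK) -(Thi g).
- move=> w [[w0|w1]|[xt _ <-]].
  + by exists (f w.1.2); rewrite s0E.
  + by exists (f' w.1.2); rewrite s1E.
  + by exists (Th xt); rewrite s2E.
pose V : set E := [set w | [set: @unit_interval R] `<=` (fun t => U (w, t))].
have oV : open V.
  rewrite openE => w Vw.
  (* Tube lemma: [V] is open because the interval is compact. *)
  have /compact_near_coveringP cI := @unit_interval_compact R.
  apply: (cI _ (nbhs w) (fun w t => U (w, t))) => t _.
  have [[P Q] [/= wP tQ] PQ] := open_nbhs_nbhs (conj oU (Vw t Logic.I)).
  by exists (Q, P) => // -[t' w'] [/= Qt' Pw']; exact: (PQ (w', t')).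
have [|W [j [q [W_ANR qj Vq]]]] :=
  GANR_neighborhood cG hG ppZ aZ z0 (S_ANR a) (p := p a) cle eI oV.
  by move=> x t _; apply: AU; right; exists (x, t).
exists W, j, (gcomp gsnd q); split => // [x|]; first by rewrite /= qj.
have Uq (wt : W * @unit_interval R) : U (q wt.1, wt.2) by exact: (Vq wt.1 wt.2).
exists (F \o lift_to Uq); split.
- apply: continuous_compose cF; apply: lift_to_continuous.
  apply: continuous_pair; last exact: snd_continuous.
  exact: (continuous_compose (@fst_continuous _ _) (@gmap_continuous _ _ _ q)).
- move=> g w t; apply: Fi; rewrite !lift_toE /=.
  by congr (_, _); exact: (gmap_equivariant q (subgroup_val g) w).
(* Both ends lie entirely in [A], so over [W] the homotopy starts and stops exactly at the
   prescribed maps. *)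
- move=> w t t0; apply: eKI; rewrite /= FE ?lift_toE; last by left; left.
  exact: s0E.
- move=> w t t1; apply: eKI; rewrite /= FE ?lift_toE; last by left; right.
  exact: s1E.
Qed.

End neighborhoods.

Lemma restrict_factor (K : gspace (subgroup_type H))
    (h : gmap (gspace_restrict H X) K) : GANR R K ->
  exists b (f : gmap (gspace_restrict H (S b)) K),
    ghomotopic R h (gcomp f (gmap_restrict H (p b))).
Proof.
(* Any index serves here; a particular [a] is imposed only in the uniqueness clause. *)
have [a] := gs_inhabited S.
have [Z [e [ppZ aZ [z0] cle eI]]] := equivariant_embedding cG hG ppX.
exact: (restrict_factor_neighborhood a ppZ aZ z0 cle eI).
Qed.

Hypothesis p_compat : forall a b (ab : gs_le a b),
  ghomotopic R (p a) (gcomp (gs_bond ab) (p b)).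
Hypothesis p_unique : forall W : gspace G, GANR R W ->
  forall a (f f' : gmap (S a) W),
  ghomotopic R (gcomp f (p a)) (gcomp f' (p a)) ->
  exists b (ab : gs_le a b),
    ghomotopic R (gcomp f (gs_bond ab)) (gcomp f' (gs_bond ab)).

(** On [W] the maps [f] and [f'] are already homotopic after [v], so it suffices to route a bonding
    map through [W] up to [G]-homotopy. Going [S c] to [S b] to [W] to [S a] agrees with the bonding
    map after composition with [p c]; uniqueness for the [G]-ANR [S a] makes them agree from some
    later [d] on. *)
Lemma restrict_unique (K : gspace (subgroup_type H)) a
    (f f' : gmap (gspace_restrict H (S a)) K) : GANR R K ->
  ghomotopic R (gcomp f (gmap_restrict H (p a)))
    (gcomp f' (gmap_restrict H (p a))) ->
  exists b (ab : gs_le a b),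
    ghomotopic R (gcomp f (gmap_restrict H (gs_bond ab)))
      (gcomp f' (gmap_restrict H (gs_bond ab))).
Proof.
move=> K_ANR ff'.
have [Z [e [ppZ aZ [z0] cle eI]]] := equivariant_embedding cG hG ppX.
have [W [j [v [W_ANR vj fv]]]] :=
  restrict_homotopy_neighborhood ppZ aZ z0 cle eI K_ANR ff'.
have [b [u ju]] := p_factor W_ANR j.
have [c [ac bc]] := gs_directed a b.
have vc : ghomotopic R (gcomp (gcomp v (gcomp u (gs_bond bc))) (p c))
    (gcomp (gs_bond ac) (p c)).
  apply: (ghomotopic_trans (g := p a)); last exact: p_compat.
  apply: (ghomotopic_trans (g := gcomp v (gcomp u (p b)))).
    apply: eq_ghomotopic (ghomotopic_compl (gcomp v u)
      (ghomotopic_sym (p_compat bc))) => //.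
  by apply: eq_ghomotopic (ghomotopic_compl v (ghomotopic_sym ju)).
have [d [cd vd]] := p_unique (S_ANR a) vc.
have ad := gs_trans ac cd.
exists d, ad.
pose w := gcomp (gcomp u (gs_bond bc)) (gs_bond cd).
have vw : ghomotopic R (gcomp v w) (gs_bond ad).
  apply: (ghomotopic_trans (g := gcomp (gs_bond ac) (gs_bond cd))).
    by apply: eq_ghomotopic vd.
  exact: gs_bond_comp.
have fw (k : gmap (gspace_restrict H (S a)) K) :
    ghomotopic R (gcomp (gcomp k (gmap_restrict H v)) (gmap_restrict H w))
      (gcomp k (gmap_restrict H (gs_bond ad))).
  by apply: eq_ghomotopic (ghomotopic_compl k (ghomotopic_restrict H vw)).
apply: ghomotopic_trans (fw f').
apply: (ghomotopic_trans (g := gcomp (gcomp f (gmap_restrict H v)) (gmap_restrict H w))).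
  exact: ghomotopic_sym.
exact: ghomotopic_compr.
Qed.

End associated_restrict.

Definition gsystem_restrict (R : realType) (G : topologicalGroupType)
    (H : closed_subgroup G) (S : gsystem R G) : gsystem R (subgroup_type H) :=
  @GSystem R (subgroup_type H) (gs_idx S) (@gs_le _ _ S) (gs_inhabited S)
    (@gs_refl _ _ S) (@gs_trans _ _ S) (@gs_directed _ _ S)
    (fun a => gspace_restrict H (S a))
    (fun a b ab => gmap_restrict H (gs_bond ab))
    (fun a aa => ghomotopic_restrict H (gs_bond_id aa))
    (fun a b c ab bc ac => ghomotopic_restrict H (gs_bond_comp ab bc ac)).

Theorem theorem1 (R : realType) (G : topologicalGroupType)
  (G_compact : compact [set: G]) (G_hausdorff : hausdorff_space G)
  (H : closed_subgroup G) (X : gspace G) (X_pparacompact : p_paracompact R X) :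
  gmovable R X -> gmovable R (gspace_restrict H X).
Proof.
move=> [S [S_ANR [p [p_compat pK]] S_movable]].
have p_factor W (W_ANR : GANR R W) := (pK W W_ANR).1.
have p_unique W (W_ANR : GANR R W) := (pK W W_ANR).2.
exists (gsystem_restrict H S); split.
- by move=> a; exact: GANR_restrict.
- exists (fun a => gmap_restrict H (p a)); split.
    by move=> a b ab; exact: (ghomotopic_restrict H (p_compat a b ab)).
  move=> K K_ANR; split=> [h|a f f' ff'].
    exact: (restrict_factor G_compact G_hausdorff X_pparacompact S_ANR p_factor h).
  exact: (restrict_unique G_compact G_hausdorff X_pparacompact S_ANR p_factor
    p_compat p_unique K_ANR ff').
move=> a; have [b [ab bP]] := S_movable a.
exists b, ab => c ac; have [r rP] := bP c ac.
exists (gmap_restrict H r); exact: (ghomotopic_restrict H rP).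
Qed.
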